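(* Let $n\ge 3$, $m\ge 1$ and let $h:\mathbb{B}^n\to\mathbb{B}^m$ be a harmonic or hyperbolic harmonic function. Then for every $x\in\mathbb{B}^n$, $$|Dh(x)|\le\begin{cases}\dfrac{n}{2}\,\dfrac{1}{1-|x|} & \text{if } h \text{ is harmonic},\\[3mm] (n-1)\,\dfrac{1}{1-|x|^2} & \text{if } h \text{ is hyperbolic harmonic},\end{cases}$$ where $|Dh(x)|=\sup_{v\in\mathbb{R}^n,\,|v|=1}|Dh(x)v|$.
   Context: $\mathbb{B}^k$ is the open unit ball of $\mathbb{R}^k$ and $|\cdot|$ the Euclidean norm. A real-valued function $u\in C^2(\mathbb{B}^n,\mathbb{R})$ is hyperbolic harmonic if $\Delta_h u=0$ on $\mathbb{B}^n$, where $$\Delta_h u(x)=(1-|x|^2)^2\Delta u(x)+2(n-2)(1-|x|^2)\sum_{i=1}^n x_i\frac{\partial u}{\partial x_i}(x)$$ and $\Delta$ is the Euclidean Laplacian. A vector-valued function is harmonic (resp. hyperbolic harmonic) if each of its components is. $Dh(x)$ is the differential of $h$ at $x$. *)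

(* Defs.v *)
From mathcomp Require Import all_boot all_order all_algebra.
From mathcomp Require Import all_classical reals topology normedtype derive.

Set Implicit Arguments.
Unset Strict Implicit.
Unset Printing Implicit Defensive.
Import Order.TTheory GRing.Theory Num.Theory.
Import numFieldNormedType.Exports.

Local Open Scope classical_set_scope.
Local Open Scope ring_scope.

(* R^n is 'rV[R]_n. The library norm `|x| on row vectors is the sup norm; it
   has the same topology, differentiability and derivatives as the Euclidean
   norm below, which is the one used for balls and for |Dh(x)|. *)
Definition enorm (R : realType) (n : nat) (x : 'rV[R]_n) : R :=
  Num.sqrt (\sum_(i < n) x 0 i ^+ 2).

Definition unit_ball (R : realType) (n : nat) : set 'rV[R]_n :=
  [set x | enorm x < 1].
Arguments unit_ball : clear implicits.

Definition partial (R : realType) (n : nat) (i : 'I_n) (f : 'rV[R]_n -> R)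
  : 'rV[R]_n -> R := fun x => 'D_(delta_mx 0 i) f x.

(* C^1 and C^2 are meant on an open set A: functions are total, and all the
   conditions at x in A only depend on the values of f near x. *)
Definition C1_on (R : realType) (n : nat) (A : set 'rV[R]_n)
    (f : 'rV[R]_n -> R) : Prop :=
  (forall x, A x -> differentiable f x) /\
  (forall i x, A x -> {for x, continuous (partial i f)}).

Definition C2_on (R : realType) (n : nat) (A : set 'rV[R]_n)
    (f : 'rV[R]_n -> R) : Prop :=
  C1_on A f /\ (forall i, C1_on A (partial i f)).

Definition laplacian (R : realType) (n : nat) (u : 'rV[R]_n -> R)
    (x : 'rV[R]_n) : R :=
  \sum_(i < n) partial i (partial i u) x.

Definition hyp_laplacian (R : realType) (n : nat) (u : 'rV[R]_n -> R)
    (x : 'rV[R]_n) : R :=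
  (1 - enorm x ^+ 2) ^+ 2 * laplacian u x
  + 2 * (n%:R - 2) * (1 - enorm x ^+ 2) * \sum_(i < n) x 0 i * partial i u x.

Definition harmonic (R : realType) (n : nat) (u : 'rV[R]_n -> R) : Prop :=
  C2_on (unit_ball R n) u /\ (forall x, unit_ball R n x -> laplacian u x = 0).

Definition hyp_harmonic (R : realType) (n : nat) (u : 'rV[R]_n -> R) : Prop :=
  C2_on (unit_ball R n) u /\
  (forall x, unit_ball R n x -> hyp_laplacian u x = 0).

Definition vharmonic (R : realType) (n m : nat) (h : 'rV[R]_n -> 'rV[R]_m)
  : Prop := forall j : 'I_m, harmonic (fun x => h x 0 j).

Definition vhyp_harmonic (R : realType) (n m : nat)
    (h : 'rV[R]_n -> 'rV[R]_m) : Prop :=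
  forall j : 'I_m, hyp_harmonic (fun x => h x 0 j).

(* This real supremum is over a bounded set, L being linear; the set is
   nonempty when n >= 1. *)
Definition opnorm (R : realType) (n m : nat)
    (L : {linear 'rV[R]_n -> 'rV[R]_m}) : R :=
  sup [set enorm (L v) | v in [set v : 'rV[R]_n | enorm v = 1]].

(* Main.v *)
Require Import Defs.
From mathcomp Require Import all_boot all_order all_algebra.
From mathcomp Require Import all_classical reals topology normedtype derive.
From mathcomp Require Import sequences realfun exp trigo.
From mathcomp Require Import ring lra.
Import Order.TTheory GRing.Theory Num.Theory.
Import numFieldNormedType.Exports.
Local Open Scope classical_set_scope.
Local Open Scope ring_scope.
Set Implicit Arguments.
Unset Strict Implicit.
Unset Printing Implicit Defensive.

(** Pairing [Dh(x) v] with the unit vector in its own direction reduces both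
    bounds to a directional derivative [D_e u(x)], [|e| = 1], of a scalar
    function [u] with [|u| <= 1]. Both are then proved with the maximum
    principle and explicit comparison functions, without Poisson kernels and
    without integrals.

    Hyperbolic case. Let [s] be half of the hyperbolic distance from [x] to
    [y], so that [sinh s ^ 2 = |x - y|^2 / ((1 - |x|^2) (1 - |y|^2))]. The bound
    is the infinitesimal form of the two-point estimate
    [u x - u y <= 2 tanh ((n - 1) s / 2)], [osc_le_profile]. To prove it one
    looks at a maximum of the difference of both sides and moves [x] and [y]
    simultaneously in mirrored directions: the reflection in the perpendicular
    bisector of [x] and [y] acts on tangent vectors by the Euclidean reflection
    along [x - y], up to the conformal factors. The sum of the second variations
    over a frame turns a function [f s] of the half distance into a multiple of
    [f'' + (n - 1) tanh s f'], which for [f = tanh ((n - 1) s / 2)] is not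
    positive because [n - 1 >= 2]. A small strictly concave term makes it
    negative ([profile_supersol]), and a small multiple of [- ln (1 - |x|^2)],
    whose hyperbolic Laplacian is bounded, forces the maximum to be attained.

    Harmonic case. After translation, dilation and antisymmetrisation the
    function [v] is defined near the closed unit ball and odd under the
    reflection in the hyperplane orthogonal to [e]; the claim is
    [beta := D_e v(0) <= n / 2] ([harmonic_center]). Write [L] for the Laplacian
    of the unit sphere plus [n - 1], which annihilates the height [t = <z, e>].
    Averaging [v] along rays with the weight [t^(n-2) - t^(-2)] gives a function
    [G] on the sphere with [L (G / n) = v - beta t], since the weighted
    expression is the derivative of [flux]. On the other hand
    [q = t ln (1 + t) / 2] satisfies [L q = p - (n / 2) t] with
    [p = (1 + (n - 1) t / 2) / (1 + t) >= 1 >= v], here by [n >= 3]. So if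
    [beta > n / 2] then [L (G / n - q) < 0] on the upper hemisphere. As [t] is a
    positive solution of [L t = 0] there, [(G / n - q) / t] has no interior
    minimum ([sphere_min_variation]). Subtracting [eps t ln t] pushes the
    minimum away from the equator, and the term [- eps / t] which it adds to the
    right-hand side absorbs all uniform errors: so the average can be cut off
    near the centre and replaced by a Riemann sum, which is again a harmonic
    function. *)

(** * Euclidean inner product *)

Definition dotv (R : realType) n (x y : 'rV[R]_n) : R :=
  \sum_(i < n) x 0 i * y 0 i.

Section Dot.
Context {R : realType} {n : nat}.
Implicit Types x y z : 'rV[R]_n.

Lemma dotvC x y : dotv x y = dotv y x.
Proof. by apply: eq_bigr => i _; rewrite mulrC. Qed.

Lemma dotvDl x y z : dotv (x + y) z = dotv x z + dotv y z.
Proof. by rewrite -big_split; apply: eq_bigr => i _; rewrite mxE mulrDl. Qed.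

Lemma dotvZl (a : R) x y : dotv (a *: x) y = a * dotv x y.
Proof. by rewrite mulr_sumr; apply: eq_bigr => i _; rewrite mxE mulrA. Qed.

Lemma dotvNl x y : dotv (- x) y = - dotv x y.
Proof. by rewrite -scaleN1r dotvZl mulN1r. Qed.

Lemma dotvBl x y z : dotv (x - y) z = dotv x z - dotv y z.
Proof. by rewrite dotvDl dotvNl. Qed.

Lemma dotvDr x y z : dotv x (y + z) = dotv x y + dotv x z.
Proof. by rewrite !(dotvC x) dotvDl. Qed.

Lemma dotvZr (a : R) x y : dotv x (a *: y) = a * dotv x y.
Proof. by rewrite !(dotvC x) dotvZl. Qed.

Lemma dotvBr x y z : dotv x (y - z) = dotv x y - dotv x z.
Proof. by rewrite !(dotvC x) dotvBl. Qed.

Definition dotvE := (dotvBl, dotvBr, dotvDl, dotvDr, dotvZl, dotvZr).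

Lemma dotv0l x : dotv 0 x = 0.
Proof. by rewrite -(scale0r 0) dotvZl mul0r. Qed.

Lemma dotv_ge0 x : 0 <= dotv x x.
Proof. by apply: sumr_ge0 => i _; rewrite -expr2 sqr_ge0. Qed.

Lemma dotv_eq0 x : (dotv x x == 0) = (x == 0).
Proof.
apply/eqP/eqP => [/eqP|->]; last exact: dotv0l.
rewrite psumr_eq0 => [/allP x0|i _]; last by rewrite -expr2 sqr_ge0.
apply/rowP => i; rewrite mxE.
by have := x0 i (mem_index_enum _); rewrite mulf_eq0 orbb => /eqP.
Qed.

Lemma enormE x : enorm x = Num.sqrt (dotv x x).
Proof. by congr Num.sqrt; apply: eq_bigr => i _; rewrite expr2. Qed.

Lemma enorm_ge0 x : 0 <= enorm x.
Proof. by rewrite enormE sqrtr_ge0. Qed.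

Lemma enorm_sqr x : enorm x ^+ 2 = dotv x x.
Proof. by rewrite enormE sqr_sqrtr // dotv_ge0. Qed.

Lemma enorm_lt1 x : (enorm x < 1) = (dotv x x < 1).
Proof.
by rewrite -enorm_sqr -[X in _ = (_ < X)](expr1n _ 2) ltr_pXn2r // nnegrE ?enorm_ge0 ?ler01.
Qed.

Lemma enorm_eq1 x : enorm x = 1 -> dotv x x = 1.
Proof. by rewrite -enorm_sqr => ->; rewrite expr1n. Qed.

Lemma coord_le_dotv x i : x 0 i ^+ 2 <= dotv x x.
Proof.
rewrite /dotv (bigD1 i) //= expr2 lerDl; apply: sumr_ge0 => j _.
by rewrite -expr2 sqr_ge0.
Qed.

Lemma cauchy_schwarz x y : dotv x y <= enorm x * enorm y.
Proof.
have [->|y0] := eqVneq y 0.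
  by rewrite dotvC dotv0l mulr_ge0 ?enorm_ge0.
have yy : 0 < dotv y y by rewrite lt_neqAle eq_sym dotv_eq0 y0 dotv_ge0.
have := dotv_ge0 (dotv y y *: x - dotv x y *: y).
rewrite !dotvE (dotvC y x) => h.
have {}h : 0 <= dotv y y * (dotv x x * dotv y y - dotv x y ^+ 2).
  by apply: le_trans h _; rewrite le_eqVlt; apply/orP; left; apply/eqP; ring.
rewrite pmulr_rge0 // subr_ge0 in h.
apply: le_trans (ler_norm _) _.
by rewrite -sqrtr_sqr !enormE -sqrtrM ?dotv_ge0 // ler_wsqrtr.
Qed.

Lemma enorm_triangle x y : enorm (x + y) <= enorm x + enorm y.
Proof.
rewrite -(@ler_pXn2r _ 2) // ?nnegrE ?addr_ge0 ?enorm_ge0 //.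
rewrite sqrrD !enorm_sqr !dotvE (dotvC y x).
have := cauchy_schwarz x y; lra.
Qed.

Lemma enormZ (a : R) x : enorm (a *: x) = `|a| * enorm x.
Proof.
by rewrite !enormE dotvZl dotvZr mulrA -expr2 sqrtrM ?sqr_ge0 // sqrtr_sqr.
Qed.

Lemma coord_le_enorm x i : `|x 0 i| <= enorm x.
Proof. by rewrite enormE -sqrtr_sqr ler_wsqrtr // coord_le_dotv. Qed.

Lemma cvg_sum (T : Type) (F : set_system T) m (f : 'I_m -> T -> R) (l : 'I_m -> R) :
  Filter F -> (forall i, f i t @[t --> F] --> l i) ->
  \sum_(i < m) f i t @[t --> F] --> \sum_(i < m) l i.
Proof. by move=> FF fl; apply: cvg_big => //; exact: add_continuous. Qed.

Lemma continuous_lincomb (T : topologicalType) m (c : 'I_m -> R)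
    (f : 'I_m -> T -> R) (t : T) :
  (forall i, {for t, continuous (f i)}) ->
  {for t, continuous (fun s => \sum_(i < m) c i * f i s)}.
Proof.
move=> cf; apply: cvg_sum => i; apply: cvgM; [exact: cvg_cst | exact: cf].
Qed.

Lemma dotv_continuous (T : topologicalType) (f g : T -> 'rV[R]_n) (t : T) :
  {for t, continuous f} -> {for t, continuous g} ->
  {for t, continuous (fun s => dotv (f s) (g s))}.
Proof.
move=> cf cg; rewrite /continuous_at /dotv.
apply: cvg_sum => i; apply: cvgM.
  exact: (cvg_comp _ _ cf (@coord_continuous _ _ _ 0 i _)).
exact: (cvg_comp _ _ cg (@coord_continuous _ _ _ 0 i _)).
Qed.

Lemma enorm_continuous : continuous (@enorm R n).
Proof.
move=> x; have -> : @enorm R n = Num.sqrt \o (fun x => dotv x x).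
  by apply/funext => y /=; rewrite enormE.
apply: continuous_comp; last exact: sqrt_continuous.
by apply: dotv_continuous; exact: cvg_id.
Qed.

Lemma enorm_le_compact (r : R) : compact [set x : 'rV[R]_n | enorm x <= r].
Proof.
apply: bounded_closed_compact.
  exists r; split; first exact: num_real.
  move=> M rM x /= xr; rewrite [leLHS]/Num.Def.normr /= mx_normrE.
  apply: bigmax_le => [|[i j] _ /=].
    exact: le_trans (enorm_ge0 x) (le_trans xr (ltW rM)).
  rewrite ord1; apply: le_trans (coord_le_enorm _ _) _.
  exact: le_trans xr (ltW rM).
apply: (closed_comp (f := @enorm R n) (D := [set y | y <= r])); last exact: closed_le.
by move=> x _; exact: enorm_continuous.
Qed.

End Dot.

(** * Differentials in coordinates *)

(** The coordinates of the differential are carried as data, so that they can be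
    transported through sums and affine maps by explicit formulas. *)
Definition has_grad (R : realType) n (u : 'rV[R]_n -> R) (x : 'rV[R]_n)
    (d : 'I_n -> R) : Prop :=
  differentiable u x /\ forall v, 'd u x v = \sum_(i < n) v 0 i * d i.

Section Grad.
Context {R : realType} {n : nat}.
Implicit Types (x v : 'rV[R]_n) (u : 'rV[R]_n -> R).

Lemma has_grad_partial u x :
  differentiable u x -> has_grad u x (fun i => partial i u x).
Proof.
move=> du; split=> // v.
rewrite [in LHS](row_sum_delta v) linear_sum; apply: eq_bigr => i _.
by rewrite linearZ /partial deriveE.
Qed.

Lemma is_derive_rV (c : R -> 'rV[R]_n) (t : R) (c' : 'rV[R]_n) :
  (forall i, is_derive t 1 (fun s => c s 0 i) (c' 0 i)) -> is_derive t 1 c c'.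
Proof.
move=> dc.
have dmx : derivable c t 1.
  by apply/derivable_mxP => i j; rewrite ord1; case: (dc j).
split=> //; rewrite derive_mx //; apply/rowP => j; rewrite mxE.
by case: (dc j).
Qed.

Lemma is_derive_curve u (c : R -> 'rV[R]_n) (t : R) (c' : 'rV[R]_n) d :
  has_grad u (c t) d ->
  (forall i, is_derive t 1 (fun s => c s 0 i) (c' 0 i)) ->
  is_derive t 1 (u \o c) (\sum_(i < n) c' 0 i * d i).
Proof.
move=> [du ud] /is_derive_rV [dc c'E].
have {}dc := (derivable1_diffP _ _).1 dc.
have duc := differentiable_comp dc du.
split; first exact/derivable1_diffP.
rewrite deriveE // diff_comp //= -[X in 'd u _ X]deriveE // c'E; exact: ud.
Qed.

Lemma is_derive_line u x v (t : R) d :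
  has_grad u (x + t *: v) d ->
  is_derive t 1 (fun s => u (x + s *: v)) (\sum_(i < n) v 0 i * d i).
Proof.
move=> ud; apply: (@is_derive_curve u (fun s => x + s *: v)) => // i.
have -> : (fun s => (x + s *: v) 0 i) = (fun s : R => x 0 i + s * v 0 i).
  by apply/funext => s; rewrite !mxE.
by apply: is_derive_eq; rewrite /= /GRing.scale /=; ring.
Qed.

Lemma affine_differentiable (x0 : 'rV[R]_n) (M : 'M[R]_n) y :
  differentiable (fun y : 'rV[R]_n => x0 + y *m M) y.
Proof.
have -> : (fun y : 'rV[R]_n => x0 + y *m M) =
    cst x0 + \sum_(k < n) (fun y : 'rV[R]_n => y 0 k *: row k M).
  apply/funext => z; rewrite mulmx_sum_row /=.
  by rewrite [RHS]/(_ + _)%R /= fct_sumE.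
apply: differentiableD => //.
apply: differentiable_sum => k; apply: differentiableZl.
exact: differentiable_coord.
Qed.

Lemma has_grad_affine u x0 (M : 'M[R]_n) y d :
  has_grad u (x0 + y *m M) d ->
  has_grad (fun y => u (x0 + y *m M)) y (fun k => \sum_(l < n) M k l * d l).
Proof.
move=> [du ud].
pose f := fun y : 'rV[R]_n => x0 + y *m M.
have df : differentiable f y by exact: affine_differentiable.
have duf : differentiable (u \o f) y by apply: differentiable_comp.
split; first exact: duf.
move=> v; rewrite -deriveE //.
have ln : is_derive (0 : R) 1 (fun s : R => u ((x0 + y *m M) + s *: (v *m M)))
   (\sum_(i < n) (v *m M) 0 i * d i).
  have ud0 : has_grad u ((x0 + y *m M) + (0 : R) *: (v *m M)) d.
    by rewrite scale0r addr0.
  exact: (is_derive_line ud0).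
have -> : 'D_v (fun y => u (x0 + y *m M)) y =
    'D_1 (fun s : R => u ((x0 + y *m M) + s *: (v *m M))) 0.
  rewrite /derive; apply: (congr1 (fun F : R -> R => lim (F @ (0 : R)^'))).
  apply/funext => h /=.
  rewrite addr0 scale0r addr0 mulmxDl -scalemxAl.
  by rewrite [X in _ = _ *: (u (_ + X *: _) - _)]mulr1 (addrC (h *: (v *m M))) addrA.
rewrite (@derive_val _ _ _ _ _ _ _ ln).
under eq_bigr do rewrite mxE mulr_suml.
rewrite exchange_big; apply: eq_bigr => k _ /=; rewrite mulr_sumr.
by apply: eq_bigr => l _; rewrite mulrA.
Qed.

Lemma has_grad_sum m (c : 'I_m -> R) (f : 'I_m -> 'rV[R]_n -> R) x
    (d : 'I_m -> 'I_n -> R) :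
  (forall j, has_grad (f j) x (d j)) ->
  has_grad (fun y => \sum_(j < m) c j * f j y) x
           (fun i => \sum_(j < m) c j * d j i).
Proof.
move=> fd.
have -> : (fun y => \sum_(j < m) c j * f j y) = \sum_(j < m) (c j *: f j).
  by apply/funext => y; rewrite fct_sumE.
have df j : differentiable (c j *: f j) x by apply: differentiableZ; case: (fd j).
have dfs : differentiable (\sum_(j < m) (c j *: f j)) x by exact: differentiable_sum.
split=> // v; rewrite -deriveE // derive_sum; last first.
  by move=> j; apply: diff_derivable.
under eq_bigr => j _.
  rewrite deriveZ; last by apply: diff_derivable; case: (fd j).
  rewrite deriveE; last by case: (fd j).
  rewrite (fd j).2 scaler_sumr.
over.
rewrite exchange_big; apply: eq_bigr => i _ /=; rewrite mulr_sumr.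
by apply: eq_bigr => j _; rewrite /GRing.scale /=; ring.
Qed.

End Grad.

(** * Functions with two derivatives *)

(** [g] and [H] stand for the gradient and the Hessian, but are not required to
    be the functions [partial i u] outside [A]: this makes the notion stable
    under the formulas of calculus without any reasoning on neighbourhoods. *)

Record jet2_on (R : realType) n (A : set 'rV[R]_n) (u : 'rV[R]_n -> R)
    (g : 'I_n -> 'rV[R]_n -> R) (H : 'I_n -> 'I_n -> 'rV[R]_n -> R) : Prop := Jet2 {
  jet_grad : forall x, A x -> has_grad u x (g ^~ x);
  jet_hess : forall i x, A x -> has_grad (g i) x (H i ^~ x);
  jet_cont : forall i j x, A x -> {for x, continuous (H i j)} }.

Section Jet.
Context {R : realType} {n : nat}.
Implicit Types (A : set 'rV[R]_n) (u : 'rV[R]_n -> R).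

Lemma C2_jet2 A u : C2_on A u ->
  jet2_on A u (fun i => partial i u) (fun i j => partial j (partial i u)).
Proof.
move=> [[du _] d2]; split=> [x Ax|i x Ax|i j x Ax].
- exact/has_grad_partial/du.
- apply: has_grad_partial; exact: (d2 i).1.
- exact: (d2 i).2.
Qed.

Lemma has_grad_continuous u x d : has_grad u x d -> {for x, continuous u}.
Proof. by case=> /differentiable_continuous. Qed.

Lemma jet2_sum m A (c : 'I_m -> R) (f : 'I_m -> 'rV[R]_n -> R)
    (g : 'I_m -> 'I_n -> 'rV[R]_n -> R) (H : 'I_m -> 'I_n -> 'I_n -> 'rV[R]_n -> R) :
  (forall j, jet2_on A (f j) (g j) (H j)) ->
  jet2_on A (fun y => \sum_(j < m) c j * f j y)
            (fun i y => \sum_(j < m) c j * g j i y)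
            (fun i k y => \sum_(j < m) c j * H j i k y).
Proof.
move=> fj; split=> [x Ax|i x Ax|i k x Ax].
- apply: (@has_grad_sum _ _ _ _ _ _ (fun j i => g j i x)) => j; exact: (jet_grad (fj j)).
- apply: (@has_grad_sum _ _ _ _ (fun j => g j i) _ (fun j k => H j i k x)) => j.
  exact: (jet_hess (fj j)).
- apply: (@continuous_lincomb _ _ _ c (fun j => H j i k)) => j.
  exact: (jet_cont (fj j)).
Qed.

Lemma jet2_affine A B u g H x0 (M : 'M[R]_n) :
  jet2_on A u g H -> (forall y, B y -> A (x0 + y *m M)) ->
  jet2_on B (fun y => u (x0 + y *m M))
    (fun k y => \sum_(l < n) M k l * g l (x0 + y *m M))
    (fun k j y => \sum_(l < n) M k l * \sum_(p < n) M j p * H l p (x0 + y *m M)).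
Proof.
move=> uj BA; split=> [y /BA Ay|k y /BA Ay|k j y /BA Ay].
- exact: (has_grad_affine (jet_grad uj Ay)).
- apply: (@has_grad_sum _ _ _ (M k) (fun l y => g l (x0 + y *m M)) _
     (fun l j => \sum_(p < n) M j p * H l p (x0 + y *m M))) => l.
  exact: (has_grad_affine (jet_hess uj l Ay)).
- apply: (@continuous_lincomb _ 'rV[R]_n _ (M k)
    (fun l (y : 'rV[R]_n) => \sum_(p < n) M j p * H l p (x0 + y *m M))) => l.
  apply: (@continuous_lincomb _ 'rV[R]_n _ (M j)
    (fun p (y : 'rV[R]_n) => H l p (x0 + y *m M))) => p.
  have cf : {for y, continuous (fun y : 'rV[R]_n => x0 + y *m M)}.
    exact/differentiable_continuous/affine_differentiable.
  apply: (@continuous_comp _ _ _ (fun y : 'rV[R]_n => x0 + y *m M) (H l p)).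
    exact: cf.
  exact: (jet_cont uj).
Qed.

End Jet.

(** * One-variable calculus *)

Section OneVariable.
Context {R : realType}.
Implicit Types f g : R -> R.

Lemma is_derive_cvg0 (f : R -> R) (d : R) : is_derive (0 : R) 1 f d ->
  h^-1 * (f h - f 0) @[h --> (0 : R)^'] --> d.
Proof.
case=> d1 <-; move: d1; rewrite /derivable /derive => /cvg_ex [l hl].
have -> : (fun h : R => h^-1 * (f h - f 0)) =
   (fun h : R => h^-1 *: ((f \o shift 0) (h *: (1 : R)) - f 0)).
  by apply/funext => h /=; rewrite addr0 [h *: 1]mulr1.
by rewrite (cvg_lim _ hl).
Qed.

Lemma deriv_le_right (f h : R -> R) (d : R) : is_derive (0 : R) 1 f d ->
  {for 0, continuous h} ->
  (\forall s \near (0 : R)^'+, f s - f 0 <= s * h s) -> d <= h 0.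
Proof.
move=> /is_derive_cvg0 /cvg_dnbhs_at_right fd ch fh.
have hh : h s @[s --> (0 : R)^'+] --> h 0 by exact: cvg_at_right_filter.
apply: (ler_cvg_to fd hh); near=> s.
have s0 : 0 < s by near: s; exact: nbhs_right_gt.
by rewrite mulrC ler_pdivrMr // mulrC; near: s.
Unshelve. all: by end_near. Qed.

Lemma near_max_test (f f1 : R -> R) (f2 : R) :
  (\forall s \near (0 : R), is_derive (s : R) 1 f (f1 s)) ->
  is_derive (0 : R) 1 f1 f2 ->
  (\forall s \near (0 : R), f s <= f 0) ->
  f1 0 = 0 /\ f2 <= 0.
Proof.
move=> df df1 fmax.
have [r /= r0 hr] : exists2 r : R, 0 < r & forall s : R, `|s| < r ->
    is_derive s 1 f (f1 s) /\ f s <= f 0.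
  have : \forall s \near (0 : R), is_derive (s : R) 1 f (f1 s) /\ f s <= f 0.
    by apply: filterS2 df fmax => s; split.
  move=> /nbhs_ballP[r /= r0 hr]; exists r => // s sr; apply: hr.
  by rewrite /ball /= sub0r normrN.
have in0 s : s \in `](- r), r[%R -> `|s| < r by rewrite in_itv /= ltr_norml.
have f10 : f1 0 = 0.
  have h0 : (0 : R) \in `](- r), r[%R by rewrite in_itv /= oppr_lt0 r0.
  have rr : - r <= r by lra.
  have [] := @derive1_at_max R f (- r) r 0 rr _ h0 _.
  - by move=> t /in0 /hr [[]].
  - by move=> t /in0 /hr [].
  - have /hr[[_ <-] _] : `|0 : R| < r by rewrite normr0.
    by [].
split=> //; rewrite leNgt; apply/negP => f20.
have dq : (fun h => h^-1 * f1 h) @ (0 : R)^' --> f2.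
  have := is_derive_cvg0 df1.
  by under eq_fun do rewrite f10 subr0.
have : \forall h \near (0 : R)^', 0 < h^-1 * f1 h by exact: (cvgr_gt _ dq).
move=> /nbhs_ballP[r' /= r'0 hr'].
have [s [s0 sr sr']] : exists s : R, [/\ 0 < s, s < r & s < r'].
  exists (Num.min r r' / 2); have m0 : 0 < Num.min r r' by rewrite lt_min r0 r'0.
  have [m1 m2] : Num.min r r' <= r /\ Num.min r r' <= r'.
    by rewrite !ge_min !lexx orbT.
  by split; lra.
have [c cs fE] : exists2 c, c \in `]0, s[%R & f s - f 0 = f1 c * (s - 0).
  apply: MVT => // [t|].
    rewrite in_itv /= => /andP[t0 ts].
    have /hr[] // : `|t| < r by rewrite gtr0_norm // (lt_trans ts).
  apply: derivable_within_continuous => t; rewrite in_itv /= => /andP[t0 ts].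
  have /hr[[]] // : `|t| < r by rewrite ger0_norm // (le_lt_trans ts).
move: cs; rewrite in_itv /= => /andP[c0 cs].
have : 0 < f1 c.
  have /= := hr' c; rewrite /ball /= sub0r normrN gtr0_norm //.
  move=> /(_ (lt_trans cs sr')) /(_ (lt0r_neq0 c0)).
  by rewrite pmulr_rgt0 // invr_gt0.
have /hr[_ fs] : `|s| < r by rewrite gtr0_norm.
move=> f1c; have : 0 < f1 c * (s - 0) by rewrite subr0 mulr_gt0.
by rewrite -fE subr_gt0 ltNge fs.
Qed.

(** The coefficients are the value and the two derivatives at [0], which is what
    is read off when a squared norm is restricted to a line. *)
Definition quad (c0 c1 c2 s : R) : R := c0 + c1 * s + c2 * s ^+ 2 / 2.

Lemma quad0 c0 c1 c2 : quad c0 c1 c2 0 = c0.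
Proof. by rewrite /quad; ring. Qed.

Lemma is_derive_quad c0 c1 c2 (s : R) :
  is_derive s 1 (quad c0 c1 c2) (c1 + c2 * s).
Proof.
rewrite /quad; apply: is_derive_eq.
by rewrite /GRing.scale /=; lra.
Qed.

End OneVariable.

(** * The comparison function of the hyperbolic distance *)

Section Profile.
Context {R : realType}.
Variables (k : nat) (eta : R).
Hypotheses (k2 : (2 <= k)%N) (eta0 : 0 <= eta).
Implicit Types p : R.

(** For [p = sinh s ^+ 2] this is [exp (- s)]. In this variable the comparison
    functions below are rational with integer exponents. *)
Definition expdist p : R := Num.sqrt (1 + p) - Num.sqrt p.

Lemma expdist_mul p : 0 <= p ->
  expdist p * (Num.sqrt (1 + p) + Num.sqrt p) = 1.
Proof.
move=> p0; rewrite /expdist -subr_sqr !sqr_sqrtr //; last by rewrite addr_ge0.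
by ring.
Qed.

Lemma expdist_gt0 p : 0 <= p -> 0 < expdist p.
Proof.
by move=> p0; rewrite subr_gt0 ltr_sqrt; lra.
Qed.

Lemma expdist_le1 p : 0 <= p -> expdist p <= 1.
Proof.
move=> p0; rewrite -(expdist_mul p0) ler_peMr //; first exact/ltW/expdist_gt0.
apply: le_trans (_ : Num.sqrt (1 + p) <= _); last by rewrite lerDl sqrtr_ge0.
by rewrite -[leLHS]sqrtr1 ler_wsqrtr // lerDl.
Qed.

Lemma is_derive_sqrt1D p : 0 < 1 + p ->
  is_derive p 1 (fun p => Num.sqrt (1 + p)) ((2 * Num.sqrt (1 + p))^-1).
Proof.
move=> p10; have h := is_derive1_sqrt p10.
have h2 : is_derive p 1 (fun p : R => 1 + p) 1 by apply: is_derive_eq; ring.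
by have := is_derive1_comp h h2; rewrite mulr1.
Qed.

Lemma is_derive_expdistX (j : nat) p : 0 < p ->
  is_derive p 1 (fun p => expdist p ^+ j)
    (- (j%:R * expdist p ^+ j / (2 * (Num.sqrt p * Num.sqrt (1 + p))))).
Proof.
move=> p0.
have b0 : 0 < Num.sqrt p by rewrite sqrtr_gt0.
have p10 : 0 < 1 + p by rewrite ltr_wpDl.
have c0 : 0 < Num.sqrt (1 + p) by rewrite sqrtr_gt0.
have d1 := is_derive_sqrt1D p10.
have d2 := is_derive1_sqrt p0.
have dz : is_derive p 1 expdist
   (- (expdist p / (2 * (Num.sqrt p * Num.sqrt (1 + p))))).
  apply: is_derive_eq; rewrite /expdist; field.
  by rewrite !gt_eqF.
case: j => [|j].
  have -> : (fun p => expdist p ^+ 0) = cst 1 by [].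
  by apply: is_derive_eq; rewrite !mul0r oppr0.
rewrite -exprfctE; apply: is_derive_eq.
rewrite /GRing.scale /= exprS; field.
by rewrite !gt_eqF.
Qed.

(** With [sinh s ^+ 2 = p], this is
    [(1 + eta) * tanh (k * s / 2) + eta * (1 - exp (- (k + 1) * s))]. The first
    term exceeds [1] at a finite distance, the second one makes the function a
    strict supersolution. *)
Definition profile p : R :=
  (1 + eta) * ((1 - expdist p ^+ k) / (1 + expdist p ^+ k))
  + eta * (1 - expdist p ^+ k.+1).

(** The derivative of [profile] with respect to [s]. *)
Definition profile_num p : R :=
  (1 + eta) * (2 * k%:R * expdist p ^+ k / (1 + expdist p ^+ k) ^+ 2)
  + eta * (k.+1%:R * expdist p ^+ k.+1).

Definition profile' p : R :=
  profile_num p / (2 * (Num.sqrt p * Num.sqrt (1 + p))).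

Lemma is_derive_profile p : 0 < p -> is_derive p 1 profile (profile' p).
Proof.
move=> p0.
have b0 : 0 < Num.sqrt p by rewrite sqrtr_gt0.
have c0 : 0 < Num.sqrt (1 + p) by rewrite sqrtr_gt0 ltr_wpDl.
have dk := is_derive_expdistX k p0.
have dk1 := is_derive_expdistX k.+1 p0.
have P0 : 0 < 1 + expdist p ^+ k.
  by rewrite addr_gt0 // exprn_gt0 // expdist_gt0 // ltW.
have di : is_derive p 1 (fun p => (1 + expdist p ^+ k)^-1)
   (k%:R * expdist p ^+ k / (2 * (Num.sqrt p * Num.sqrt (1 + p)))
    / (1 + expdist p ^+ k) ^+ 2).
  apply: is_derive_eq; first by apply: is_deriveV; rewrite gt_eqF.
  rewrite /GRing.scale /=; field.
  by rewrite !gt_eqF.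
rewrite /profile; apply: is_derive_eq.
rewrite /GRing.scale /= /profile' /profile_num.
set P := expdist p ^+ k in P0 *; set Q := expdist p ^+ k.+1.
by field; rewrite !gt_eqF.
Qed.

(** This is [tanh s <= tanh (k * s / 2)]. *)
Lemma expdist_tanh p : 0 <= p ->
  Num.sqrt p / Num.sqrt (1 + p) <= (1 - expdist p ^+ k) / (1 + expdist p ^+ k).
Proof.
move=> p0.
have z0 := expdist_gt0 p0; have z1 := expdist_le1 p0.
have c0 : 0 < Num.sqrt (1 + p) by rewrite sqrtr_gt0 ltr_wpDr.
have P0 : 0 < 1 + expdist p ^+ k by rewrite addr_gt0 // exprn_gt0.
rewrite ler_pdivrMr // mulrAC ler_pdivlMr //.
have zk : expdist p ^+ k <= expdist p ^+ 2 by rewrite ler_wiXn2l // ltW.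
have := expdist_mul p0; rewrite /expdist in z0 z1 zk *.
set b := Num.sqrt p in z0 z1 zk *; set c := Num.sqrt (1 + p) in c0 z0 z1 zk *.
have b0 : 0 <= b by rewrite sqrtr_ge0.
move=> e1.
have : (c - b) ^+ k * (c + b) <= (c - b) ^+ 2 * (c + b).
  by rewrite ler_wpM2r // addr_ge0 // ltW.
have -> : (c - b) ^+ 2 * (c + b) = c - b by rewrite expr2 -mulrA e1 mulr1.
lra.
Qed.

(** In the variable [s] the left-hand side is [f'' + k * tanh s * f']. On
    [tanh (k * s / 2)] this has the sign of [tanh s - tanh (k * s / 2)], and on
    [1 - exp (- (k + 1) * s)] it is at most [- (k + 1) * exp (- (k + 1) * s)]
    because [k * tanh s <= k]. *)
Lemma profile_supersol p : 0 < p ->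
  exists2 F2 : R, is_derive p 1 profile' F2 &
    4 * p * (1 + p) * F2 + (2 + 2 * (k%:R + 2) * p) * profile' p
    <= - (eta * k.+1%:R * expdist p ^+ k.+1).
Proof.
move=> p0.
have b0 : 0 < Num.sqrt p by rewrite sqrtr_gt0.
have p10 : 0 < 1 + p by rewrite ltr_wpDl.
have c0 : 0 < Num.sqrt (1 + p) by rewrite sqrtr_gt0.
have d1 := is_derive_sqrt1D p10.
have d2 := is_derive1_sqrt p0.
have dk := is_derive_expdistX k p0.
have dk1 := is_derive_expdistX k.+1 p0.
have P0 : 0 < 1 + expdist p ^+ k.
  by rewrite addr_gt0 // exprn_gt0 // expdist_gt0 // ltW.
have tb := expdist_tanh (ltW p0).
have bE : Num.sqrt p ^+ 2 = p by rewrite sqr_sqrtr // ltW.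
have cE : Num.sqrt (1 + p) ^+ 2 = 1 + p by rewrite sqr_sqrtr // ltW.
have Q0 : 0 < expdist p ^+ k.+1 by rewrite exprn_gt0 // expdist_gt0 // ltW.
have Pk0 : 0 < expdist p ^+ k by rewrite exprn_gt0 // expdist_gt0 // ltW.
have di : is_derive p 1 (fun p => (1 + expdist p ^+ k) ^- 2)
   (2 * k%:R * expdist p ^+ k / (2 * (Num.sqrt p * Num.sqrt (1 + p)))
    / (1 + expdist p ^+ k) ^+ 3).
  apply: is_derive_eq.
    by apply: is_deriveV; rewrite expf_eq0 /= gt_eqF.
  rewrite /GRing.scale /=; field.
  by rewrite !gt_eqF.
have dm : is_derive p 1 (fun p => (2 * (Num.sqrt p * Num.sqrt (1 + p)))^-1)
   (- (1 + 2 * p) / (4 * (Num.sqrt p * Num.sqrt (1 + p)) ^+ 3)).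
  apply: is_derive_eq.
    by apply: is_deriveV; rewrite gt_eqF // !mulr_gt0.
  have -> : 1 + 2 * p = Num.sqrt p ^+ 2 + Num.sqrt (1 + p) ^+ 2.
    by rewrite bE cE; ring.
  rewrite /GRing.scale /=.
  field.
  by rewrite !gt_eqF.
set P := expdist p ^+ k in P0 Pk0 tb di *; set Q := expdist p ^+ k.+1 in Q0 *.
set b := Num.sqrt p in b0 bE tb *; set c := Num.sqrt (1 + p) in c0 cE tb *.
pose X := (1 + eta) * (2 * k%:R ^+ 2 * P * (1 - P) / (1 + P) ^+ 3)
   + eta * (k.+1%:R ^+ 2 * Q).
(* [X] is the derivative of [- profile_num] with respect to [s]. *)
exists (- X / (4 * (b * c) ^+ 2) - profile_num p * (1 + 2 * p) / (4 * (b * c) ^+ 3)).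
  rewrite /profile' /profile_num; apply: is_derive_eq.
  rewrite /GRing.scale /= -/P -/Q -/b -/c /X; field.
  by rewrite !gt_eqF.
have -> : 4 * p * (1 + p) *
    (- X / (4 * (b * c) ^+ 2) - profile_num p * (1 + 2 * p) / (4 * (b * c) ^+ 3))
    + (2 + 2 * (k%:R + 2) * p) * profile' p
    = - X + k%:R * profile_num p * (b / c).
  rewrite /profile' -/b -/c -cE -[p in 2 * p]bE -[p in _ * p * c ^+ 2]bE.
  rewrite -[p in 2 * (k%:R + 2) * p]bE.
  have e1 : c ^+ 2 = 1 + b ^+ 2 by rewrite cE bE.
  have -> : 2 + 2 * (k%:R + 2) * b ^+ 2
     = 2 * (c ^+ 2 - b ^+ 2) + 2 * (k%:R + 2) * b ^+ 2 by rewrite e1; ring.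
  have -> : 1 + 2 * b ^+ 2 = b ^+ 2 + c ^+ 2 by rewrite e1; ring.
  by field; rewrite !gt_eqF.
have bc1 : b / c <= 1.
  by rewrite ler_pdivrMr // mul1r /b /c ler_wsqrtr // lerDr.
rewrite /X /profile_num -/P -/Q.
set T := (1 - P) / (1 + P) in tb *; set S := b / c in tb bc1 *.
have -> : 2 * k%:R ^+ 2 * P * (1 - P) / (1 + P) ^+ 3
   = 2 * k%:R ^+ 2 * (P / (1 + P) ^+ 2) * T.
  by rewrite /T; field; rewrite gt_eqF.
have W0 : 0 <= (1 + eta) * (2 * k%:R ^+ 2 * (P / (1 + P) ^+ 2)) * (T - S).
  apply: mulr_ge0; last by rewrite subr_ge0.
  apply: mulr_ge0; first by rewrite addr_ge0.
  have [PW P0W] := (ltW Pk0, ltW P0).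
  by rewrite !mulr_ge0 ?invr_ge0 ?exprn_ge0 // ltW // expdist_gt0 // ltW.
have W1 : 0 <= eta * Q * k.+1%:R * (k%:R * (1 - S)).
  by rewrite !mulr_ge0 ?subr_ge0 // (ltW Q0).
have kE : k.+1%:R = k%:R + 1 :> R by rewrite -natr1.
rewrite kE in W1 *.
rewrite -subr_ge0; move: W0 W1.
set Y := P / (1 + P) ^+ 2.
have -> : 2 * k%:R * P / (1 + P) ^+ 2 = 2 * k%:R * Y by rewrite /Y; ring.
move=> W0 W1; apply: le_trans (addr_ge0 W0 W1) _.
by rewrite le_eqVlt; apply/orP; left; apply/eqP; ring.
Qed.

End Profile.

(** * Two-point comparison for hyperbolic harmonic functions *)

Section Doubling.
Context {R : realType}.

Lemma profile_ge0 (k : nat) (eta p : R) : 0 <= eta -> 0 <= p ->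
  0 <= profile k eta p.
Proof.
move=> eta0 p0; have z0 := expdist_gt0 p0; have z1 := expdist_le1 p0.
have zj j : 0 < expdist p ^+ j <= 1 by rewrite exprn_gt0 // exprn_ile1 // ltW.
have /andP[a0 a1] := zj k; have /andP[b0 b1] := zj k.+1.
apply: addr_ge0; apply: mulr_ge0; rewrite ?subr_ge0 ?addr_ge0 //.
by rewrite divr_ge0 ?subr_ge0 ?addr_ge0 // ltW.
Qed.

Lemma profile_ge1 (k : nat) (eta p : R) : (0 < k)%N -> 0 < eta -> 0 <= p ->
  expdist p <= eta / (2 + eta) -> 1 <= profile k eta p.
Proof.
move=> k0 eta0 p0 zs; have z0 := expdist_gt0 p0; have z1 := expdist_le1 p0.
have zj j : 0 < expdist p ^+ j <= 1 by rewrite exprn_gt0 // exprn_ile1 // ltW.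
have /andP[a0 a1] := zj k; have /andP[b0 b1] := zj k.+1.
have zk : expdist p ^+ k <= expdist p.
  by rewrite -[leRHS]expr1 ler_wiXn2l // ltW.
rewrite -[leLHS]addr0 lerD // ?mulr_ge0 ?subr_ge0 ?(ltW eta0) //.
rewrite mulrA ler_pdivlMr ?addr_gt0 // mul1r.
have {}zs := le_trans zk zs; rewrite ler_pdivlMr ?addr_gt0 // in zs.
lra.
Qed.

Lemma profile_continuous (k : nat) (eta p : R) : 0 <= p ->
  {for p, continuous (profile k eta)}.
Proof.
move=> p0; have z0 := expdist_gt0 p0.
have cz : {for p, continuous (@expdist R)}.
  apply: cvgB; last exact: sqrt_continuous.
  apply: (@continuous_comp _ _ _ (fun q : R => 1 + q) Num.sqrt).
    by apply: cvgD; [exact: cvg_cst | exact: cvg_id].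
  exact: sqrt_continuous.
have czj j : {for p, continuous (fun q : R => expdist q ^+ j)}.
  apply: (@continuous_comp _ _ _ (@expdist R) (fun z => z ^+ j)) => //.
  exact: exprn_continuous.
rewrite /profile; apply: cvgD.
  apply: cvgM; first exact: cvg_cst.
  apply: cvgM.
    by apply: cvgB; [exact: cvg_cst | exact: czj].
  apply: cvgV; first by rewrite gt_eqF // addr_gt0 // exprn_gt0.
  by apply: cvgD; [exact: cvg_cst | exact: czj].
apply: cvgM; first exact: cvg_cst.
by apply: cvgB; [exact: cvg_cst | exact: czj].
Qed.

Context {n : nat}.
Implicit Types x y a b : 'rV[R]_n.

Definition rho x : R := 1 - dotv x x.

(** The squared hyperbolic sine of half the hyperbolic distance. *)
Definition psi x y : R := dotv (x - y) (x - y) / (rho x * rho y).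

Lemma unit_ball_rho x : unit_ball R n x <-> 0 < rho x.
Proof. by rewrite /unit_ball /= enorm_lt1 subr_gt0. Qed.

Lemma rho_line x a (s : R) :
  rho (x + s *: a) = quad (rho x) (- 2 * dotv x a) (- 2 * dotv a a) s.
Proof. by rewrite /rho /quad !dotvE (dotvC a x); field. Qed.

Lemma dist_line x y a b (s : R) :
  dotv (x + s *: a - (y + s *: b)) (x + s *: a - (y + s *: b)) =
  quad (dotv (x - y) (x - y)) (2 * dotv (x - y) (a - b))
       (2 * dotv (a - b) (a - b)) s.
Proof.
rewrite /quad !dotvE (dotvC a x) (dotvC b x) (dotvC y x) (dotvC b y) (dotvC a y).
by rewrite (dotvC b a); field.
Qed.

(** First derivative of [ln psi] when [x] and [y] move on straight lines with
    velocities [a] and [b]. Logarithmic derivatives turn the product in [psi]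
    into a sum. *)
Definition dlnpsi x y a b : R :=
  2 * dotv (x - y) (a - b) / dotv (x - y) (x - y)
  + 2 * dotv x a / rho x + 2 * dotv y b / rho y.

(** Opposite of the second derivative of [ln rho] along a line. *)
Definition mddlnrho x a : R :=
  (2 * dotv a a * rho x + 4 * dotv x a ^+ 2) / rho x ^+ 2.

(** The second derivative which goes with [dlnpsi]. *)
Definition ddlnpsi x y a b : R :=
  (2 * dotv (a - b) (a - b) * dotv (x - y) (x - y)
   - 4 * dotv (x - y) (a - b) ^+ 2) / dotv (x - y) (x - y) ^+ 2
  + mddlnrho x a + mddlnrho y b.

Definition gradv (g : 'I_n -> 'rV[R]_n -> R) x a : R :=
  \sum_(i < n) a 0 i * g i x.

Definition hessv (H : 'I_n -> 'I_n -> 'rV[R]_n -> R) x a : R :=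
  \sum_(j < n) a 0 j * \sum_(i < n) a 0 i * H i j x.

(** The last term tends to [- oo] at the boundary of the ball, so that a positive
    supremum is attained. *)
Definition doubled (u : 'rV[R]_n -> R) (k : nat) (eta eps : R) x y : R :=
  u x - u y - 2 * profile k eta (psi x y) + eps * (ln (rho x) + ln (rho y)).

Lemma near_quad_gt0 (c0 c1 c2 : R) : 0 < c0 ->
  \forall s \near (0 : R), 0 < quad c0 c1 c2 s.
Proof.
move=> c0_gt0.
have : {for (0 : R), continuous (quad c0 c1 c2)}.
  apply/differentiable_continuous/derivable1_diffP.
  by have [] := is_derive_quad c0 c1 c2 0.
by move=> /cvgr_gt; apply; rewrite quad0.
Qed.

Lemma is_derive_dlog (c0 c1 c2 s : R) : quad c0 c1 c2 s != 0 ->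
  is_derive s 1 (fun s => (c1 + c2 * s) / quad c0 c1 c2 s)
    ((c2 * quad c0 c1 c2 s - (c1 + c2 * s) ^+ 2) / quad c0 c1 c2 s ^+ 2).
Proof.
move=> q0; have dq := is_derive_quad c0 c1 c2 s.
have dv := is_deriveV q0 dq.
apply: is_derive_eq.
rewrite /GRing.scale /=; by field.
Qed.

Lemma jet_line A u g H x a (s : R) : jet2_on A u g H -> A (x + s *: a) ->
  is_derive s 1 (fun s => u (x + s *: a)) (gradv g (x + s *: a) a)
  /\ is_derive s 1 (fun s => gradv g (x + s *: a) a) (hessv H (x + s *: a) a).
Proof.
move=> uj Ax; split; first exact: is_derive_line (jet_grad uj Ax).
apply: (@is_derive_line _ _ (fun z => gradv g z a) x a s
   (fun j => \sum_(i < n) a 0 i * H i j (x + s *: a))).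
exact: (@has_grad_sum _ _ _ (fun i => a 0 i) g _
   (fun i j => H i j (x + s *: a)) (fun i => jet_hess uj i Ax)).
Qed.

(** First and second order conditions at a maximum, along a pair of lines; the
    first one serves to eliminate the drift of the hyperbolic Laplacian. *)
Lemma doubled_variation u g H k eta eps x y a b F2 :
  jet2_on (unit_ball R n) u g H -> unit_ball R n x -> unit_ball R n y -> x != y ->
  is_derive (psi x y) 1 (profile' k eta) F2 ->
  (\forall s \near (0 : R),
     doubled u k eta eps (x + s *: a) (y + s *: b) <= doubled u k eta eps x y) ->
  gradv g x a - gradv g y b =
    2 * (profile' k eta (psi x y) * (psi x y * dlnpsi x y a b))
    + eps * (2 * dotv x a / rho x + 2 * dotv y b / rho y)
  /\ hessv H x a - hessv H y b <=
    2 * (F2 * (psi x y * dlnpsi x y a b) ^+ 2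
         + profile' k eta (psi x y)
           * (psi x y * (dlnpsi x y a b ^+ 2 + ddlnpsi x y a b)))
    + eps * (mddlnrho x a + mddlnrho y b).
Proof.
move=> uj Bx By xy dF hmax.
have A0 := (unit_ball_rho x).1 Bx; have B0 := (unit_ball_rho y).1 By.
have D0 : 0 < dotv (x - y) (x - y).
  by rewrite lt_neqAle eq_sym dotv_eq0 subr_eq0 xy dotv_ge0.
pose A := quad (rho x) (- 2 * dotv x a) (- 2 * dotv a a).
pose B := quad (rho y) (- 2 * dotv y b) (- 2 * dotv b b).
pose D := quad (dotv (x - y) (x - y)) (2 * dotv (x - y) (a - b))
       (2 * dotv (a - b) (a - b)).
pose lA s : R := (- 2 * dotv x a + - 2 * dotv a a * s) / A s.
pose lB s : R := (- 2 * dotv y b + - 2 * dotv b b * s) / B s.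
pose lD s : R := (2 * dotv (x - y) (a - b) + 2 * dotv (a - b) (a - b) * s) / D s.
pose l s := lD s - lA s - lB s.
pose ps s := D s / (A s * B s).
have psE s : psi (x + s *: a) (y + s *: b) = ps s.
  by rewrite /psi dist_line !rho_line.
have der_ps s : 0 < A s -> 0 < B s -> 0 < D s ->
    is_derive s 1 ps (ps s * l s).
  move=> As Bs Ds.
  have dA : is_derive s 1 A (- 2 * dotv x a + - 2 * dotv a a * s).
    exact: is_derive_quad.
  have dB : is_derive s 1 B (- 2 * dotv y b + - 2 * dotv b b * s).
    exact: is_derive_quad.
  have dD : is_derive s 1 D
     (2 * dotv (x - y) (a - b) + 2 * dotv (a - b) (a - b) * s).
    exact: is_derive_quad.
  have AB0 : (A * B) s != 0 by rewrite gt_eqF // mulr_gt0.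
  have dAB := is_deriveV AB0 (is_deriveM dA dB).
  have -> : ps = D * (fun t : R => ((A * B) t)^-1) by [].
  apply: is_derive_eq.
  rewrite /GRing.scale /= /ps /l /lA /lB /lD.
  have -> : (A * B) s = A s * B s by [].
  have -> : (D * (fun t : R => ((A * B) t)^-1)) s = D s / (A s * B s) by [].
  field.
  by rewrite !gt_eqF.
pose th s := doubled u k eta eps (x + s *: a) (y + s *: b).
pose th1 s := gradv g (x + s *: a) a - gradv g (y + s *: b) b
  - 2 * (profile' k eta (ps s) * (ps s * l s)) + eps * (lA s + lB s).
have nA : \forall s \near (0 : R), 0 < A s by apply: near_quad_gt0.
have nB : \forall s \near (0 : R), 0 < B s by apply: near_quad_gt0.
have nD : \forall s \near (0 : R), 0 < D s by apply: near_quad_gt0.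
have dth : \forall s \near (0 : R), is_derive (s : R) 1 th (th1 s).
  near=> s.
  have As : 0 < A s by near: s.
  have Bs : 0 < B s by near: s.
  have Ds : 0 < D s by near: s.
  have Bxs : unit_ball R n (x + s *: a) by apply/unit_ball_rho; rewrite rho_line.
  have Bys : unit_ball R n (y + s *: b) by apply/unit_ball_rho; rewrite rho_line.
  have [d1 _] := jet_line uj Bxs; have [d2 _] := jet_line uj Bys.
  have ps0 : 0 < ps s by rewrite divr_gt0 // mulr_gt0.
  have d3 := is_derive1_comp (is_derive_profile k eta ps0) (der_ps s As Bs Ds).
  have d4 := is_derive1_comp (is_derive1_ln As) (is_derive_quad _ _ _ s).
  have d5 := is_derive1_comp (is_derive1_ln Bs) (is_derive_quad _ _ _ s).
  have thE : th = (fun s => u (x + s *: a)) - (fun s => u (y + s *: b))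
     - 2 *: (profile k eta \o ps) + eps *: ((@ln R \o A) + (@ln R \o B)).
    by apply/funext => t; rewrite /th /doubled psE !rho_line.
  rewrite thE.
  have d6 := is_deriveD (is_deriveB (is_deriveB d1 d2) (is_deriveZ 2 d3))
    (is_deriveZ eps (is_deriveD d4 d5)).
  apply: (is_derive_eq d6).
  by rewrite /GRing.scale /= /th1 /lA /lB !(mulrC (_^-1)).
have dth1 : is_derive (0 : R) 1 th1
   (hessv H x a - hessv H y b - 2 * (F2 * (psi x y * dlnpsi x y a b) ^+ 2
         + profile' k eta (psi x y)
           * (psi x y * (dlnpsi x y a b ^+ 2 + ddlnpsi x y a b)))
    - eps * (mddlnrho x a + mddlnrho y b)).
  have As : 0 < A 0 by rewrite /A quad0.
  have Bs : 0 < B 0 by rewrite /B quad0.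
  have Ds : 0 < D 0 by rewrite /D quad0.
  have Bxs : unit_ball R n (x + (0 : R) *: a) by rewrite scale0r addr0.
  have Bys : unit_ball R n (y + (0 : R) *: b) by rewrite scale0r addr0.
  have [_ d1] := jet_line uj Bxs; have [_ d2] := jet_line uj Bys.
  have dps := der_ps 0 As Bs Ds.
  have ps0E : ps 0 = psi x y by rewrite -psE !scale0r !addr0.
  have l0E : l 0 = dlnpsi x y a b.
    rewrite /l /lA /lB /lD /dlnpsi /A /B /D !quad0 !mulr0 !addr0; ring.
  have dF' : is_derive (ps 0) 1 (profile' k eta) F2 by rewrite ps0E.
  have d3 := is_derive1_comp dF' dps.
  have dlA := is_derive_dlog (lt0r_neq0 As).
  have dlB := is_derive_dlog (lt0r_neq0 Bs).
  have dlD := is_derive_dlog (lt0r_neq0 Ds).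
  rewrite -/A -/lA in dlA; rewrite -/B -/lB in dlB; rewrite -/D -/lD in dlD.
  have th1E : th1 = (fun s => gradv g (x + s *: a) a)
     - (fun s => gradv g (y + s *: b) b)
     - 2 *: ((profile' k eta \o ps) * (ps * (lD - lA - lB))) + eps *: (lA + lB).
    by apply/funext => t.
  rewrite th1E.
  have dl := is_deriveM d3 (is_deriveM dps (is_deriveB (is_deriveB dlD dlA) dlB)).
  have d6 := is_deriveD (is_deriveB (is_deriveB d1 d2) (is_deriveZ 2 dl))
    (is_deriveZ eps (is_deriveD dlA dlB)).
  apply: (is_derive_eq d6).
  rewrite !(scale0r a) !(scale0r b) !addr0 /GRing.scale /=.
  have -> : (ps * (lD - lA - lB)) 0 = ps 0 * l 0 by [].
  have -> : (lD - lA - lB) 0 = l 0 by [].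
  rewrite ps0E l0E /ddlnpsi /mddlnrho /A /B /D !quad0 !mulr0 !addr0.
  set q := dlnpsi x y a b; set f := profile' _ _ _.
  by field; rewrite !gt_eqF.
have [] := near_max_test dth dth1.
  have -> : th 0 = doubled u k eta eps x y by rewrite /th !scale0r !addr0.
  exact: hmax.
rewrite /th1 -psE /l /lA /lB /lD /A /B /D !quad0 !scale0r !addr0 !mulr0 !addr0.
move=> e1 e2; split; last by move: e2; lra.
move: e1; rewrite /dlnpsi.
have -> : 2 * dotv (x - y) (a - b) / dotv (x - y) (x - y) - -2 * dotv x a / rho x
  - -2 * dotv y b / rho y = 2 * dotv (x - y) (a - b) / dotv (x - y) (x - y)
  + 2 * dotv x a / rho x + 2 * dotv y b / rho y by ring.
have -> : -2 * dotv x a / rho x + -2 * dotv y b / rho y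
   = - (2 * dotv x a / rho x + 2 * dotv y b / rho y) by ring.
lra.
Unshelve. all: by end_near. Qed.

End Doubling.

(** * Reflections and traces *)

Section Reflection.
Context {R : realType} {n : nat}.
Implicit Types (x y w : 'rV[R]_n) (M : 'M[R]_n).

Definition reflm w : 'M[R]_n := 1%:M - (2 / dotv w w) *: (w^T *m w).

Lemma mulmx_tr_dotv x y : x *m y^T = (dotv x y)%:M.
Proof.
apply/matrixP => i j; rewrite !ord1 !mxE eqxx mulr1n.
by apply: eq_bigr => k _; rewrite mxE.
Qed.

Lemma reflm_tr w : (reflm w)^T = reflm w.
Proof. by rewrite /reflm linearB linearZ /= trmx1 trmx_mul trmxK. Qed.

Lemma mulmx_reflm x w : x *m reflm w = x - (2 * dotv x w / dotv w w) *: w.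
Proof.
rewrite /reflm mulmxBr mulmx1 -scalemxAr mulmxA mulmx_tr_dotv mul_scalar_mx.
by rewrite scalerA mulrAC.
Qed.

Lemma reflm_sqr w : dotv w w != 0 -> reflm w *m reflm w = 1%:M.
Proof.
move=> w0; rewrite {1}/reflm mulmxBl mul1mx -scalemxAl -mulmxA mulmx_reflm.
have -> : w - (2 * dotv w w / dotv w w) *: w = - w.
  by rewrite mulfK // -{1}[w]scale1r -scalerBl (_ : 1 - 2 = -1) ?scaleN1r //; ring.
by rewrite mulmxN scalerN opprK /reflm subrK.
Qed.

Lemma dotv_row x M i : dotv x (row i M) = (x *m M^T) 0 i.
Proof. by rewrite mxE; apply: eq_bigr => j _; rewrite !mxE. Qed.

(** The trace of the Hessian may be computed in any orthogonal frame. *)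
Lemma sum_hessv_rows (H : 'I_n -> 'I_n -> 'rV[R]_n -> R) x M (r : R) :
  M^T *m M = r%:M ->
  \sum_(i < n) hessv H x (row i M) = r * \sum_(i < n) H i i x.
Proof.
move=> MM.
have MMjl j l : \sum_(i < n) M i j * M i l = r *+ (j == l).
  have := congr1 (fun N : 'M[R]_n => N j l) MM; rewrite !mxE => <-.
  by apply: eq_bigr => i _; rewrite mxE.
rewrite /hessv exchange_big mulr_sumr; apply: eq_bigr => j _ /=.
under eq_bigr do rewrite mulr_sumr.
rewrite exchange_big (bigD1 j) //= [X in _ + X]big1 => [|l lj].
  have <- : \sum_(i < n) M i j * M i j = r by rewrite MMjl eqxx.
  rewrite addr0 mulr_suml; apply: eq_bigr => i _.
  by rewrite !mxE mulrA.
transitivity (\sum_(i < n) M i j * M i l * H l j x).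
  by apply: eq_bigr => i _; rewrite !mxE mulrA.
by rewrite -mulr_suml MMjl eq_sym (negbTE lj) mul0r.
Qed.

Lemma sum_quadratic x w (c0 c1 c2 c3 : R) :
  \sum_(i < n) (c0 + c1 * x 0 i ^+ 2 + c2 * (x 0 i * w 0 i) + c3 * w 0 i ^+ 2)
  = n%:R * c0 + c1 * dotv x x + c2 * dotv x w + c3 * dotv w w.
Proof.
rewrite !big_split /= sumr_const card_ord mulr_natl -!mulr_sumr /dotv.
by do 2 (congr (_ + _)); congr (_ + _ * _); apply: eq_bigr => i _; rewrite expr2.
Qed.

End Reflection.


(** * The coupled second variation *)

Section Supersolution.
Context {R : realType} {n : nat}.
Implicit Types (x y w : 'rV[R]_n).

Section AtAPair.
Variables x y : 'rV[R]_n.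
Hypotheses (Bx : unit_ball R n x) (By : unit_ball R n y) (xy : x != y).

(* The frames are scaled by the conformal factors of the metric, and [b i] is the
   mirror image of [a i] under the isometry which exchanges [x] and [y]. *)
Let A := rho x.
Let B := rho y.
Let D := dotv (x - y) (x - y).
Let a i := row i (A%:M : 'M[R]_n).
Let b i := row i (B *: reflm (x - y)).

Let A0 : A != 0. Proof. by rewrite gt_eqF //; exact/unit_ball_rho. Qed.
Let B0 : B != 0. Proof. by rewrite gt_eqF //; exact/unit_ball_rho. Qed.
Let D0 : D != 0. Proof. by rewrite dotv_eq0 subr_eq0. Qed.

Let xx : dotv x x = 1 - A. Proof. by rewrite /A /rho; ring. Qed.
Let yy : dotv y y = 1 - B. Proof. by rewrite /B /rho; ring. Qed.
Let xw : dotv x (x - y) = (D + B - A) / 2.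
Proof. by rewrite /D /A /B /rho !dotvE (dotvC y x); field. Qed.
Let yw : dotv y (x - y) = (B - A - D) / 2.
Proof. by rewrite /D /A /B /rho !dotvE (dotvC y x); field. Qed.

Let dot_a v i : dotv v (a i) = A * v 0 i.
Proof. by rewrite dotv_row tr_scalar_mx mul_mx_scalar mxE. Qed.

Let dot_b v i : dotv v (b i) = B * (v 0 i - 2 * dotv v (x - y) / D * (x - y) 0 i).
Proof.
by rewrite dotv_row linearZ /= reflm_tr -scalemxAr mxE mulmx_reflm !mxE.
Qed.

Let dot_aa i : dotv (a i) (a i) = A ^+ 2.
Proof. by rewrite dot_a !mxE eqxx mulr1n expr2. Qed.

Let dot_ab i : dotv (a i) (b i) = A * B * (1 - 2 / D * (x - y) 0 i ^+ 2).
Proof. by rewrite dot_b (dotvC (a i)) dot_a !mxE eqxx mulr1n; ring. Qed.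

Let dot_bb i : dotv (b i) (b i) = B ^+ 2.
Proof.
rewrite dot_b (dotvC (b i)) dot_b -/D.
have -> : b i 0 i = B * (1 - 2 / D * (x - y) 0 i ^+ 2).
  rewrite /b /reflm !mxE big_ord1 !mxE eqxx mulr1n -/D; ring.
field.
by [].
Qed.

Let dlnpsi_ab i : dlnpsi x y (a i) (b i) =
  4 * x 0 i + 4 * A / D * (x - y) 0 i.
Proof.
rewrite /dlnpsi -/A -/B -/D dotvBr !dot_a !dot_b yw -/D !mxE; field.
by rewrite A0 B0 D0.
Qed.

Let ddlnpsi_ab i : ddlnpsi x y (a i) (b i) =
  2 * (A - B) ^+ 2 / D + 2 * (A + B)
  + 8 * x 0 i ^+ 2 + (- 8 * (B - A) / D) * (x 0 i * (x - y) 0 i)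
  + (8 * A * B / D ^+ 2 - 4 * (A + B) ^+ 2 / D ^+ 2 + 4 * (B - A) ^+ 2 / D ^+ 2)
    * (x - y) 0 i ^+ 2.
Proof.
rewrite /ddlnpsi /mddlnrho -/A -/B -/D [dotv (a i - b i) _]dotvBl !(dotvBr _ (a i)).
rewrite (dotvC (b i) (a i)) dot_aa dot_ab dot_bb !dot_a !dot_b yw -/D.
have -> : y 0 i = x 0 i - (x - y) 0 i by rewrite !mxE; ring.
set wi := (x - y) 0 i.
field.
by rewrite A0 B0 D0.
Qed.

(** The squared gradient of [ln psi] along the mirrored frames; as
    [A * B / D] is the inverse of [psi], [psi] itself has squared gradient
    [16 * psi * (1 + psi)]. *)
Lemma sum_dlnpsi_sqr : \sum_i dlnpsi x y (a i) (b i) ^+ 2 = 16 * (1 + A * B / D).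
Proof.
under eq_bigr => i _.
  rewrite dlnpsi_ab (_ : _ ^+ 2 = 0 + 16 * x 0 i ^+ 2
    + (32 * A / D) * (x 0 i * (x - y) 0 i) + (16 * A ^+ 2 / D ^+ 2) * (x - y) 0 i ^+ 2).
  over.
  by field.
rewrite sum_quadratic xx xw -/D; field.
by [].
Qed.

(** The second summand is the first order part of the hyperbolic Laplacian at
    both points. With [sum_dlnpsi_sqr] the full operator sends [psi] to
    [8 + 8 * (n + 1) * psi], a function of [psi] alone. *)
Lemma sum_ddlnpsi : \sum_i ddlnpsi x y (a i) (b i)
  + 2 * (n%:R - 2) * dlnpsi x y (A *: x) (B *: y)
  = 8 * (n%:R - 1) - 8 * A * B / D.
Proof.
under eq_bigr do rewrite ddlnpsi_ab.
rewrite sum_quadratic xx xw -/D /dlnpsi -/A -/B -/D dotvBr !dotvZr !(dotvC (x - y)).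
rewrite xw yw xx yy.
field.
by rewrite A0 B0 D0.
Qed.

Lemma sum_mddlnrho : \sum_i (mddlnrho x (a i) + mddlnrho y (b i))
  = 2 * n%:R * (A + B) + 8 - 4 * (A + B).
Proof.
have mdE i : mddlnrho x (a i) + mddlnrho y (b i) = 2 * (A + B) + 8 * x 0 i ^+ 2
    + (- 8 * (B - A) / D) * (x 0 i * (x - y) 0 i)
    + (4 * (B - A) ^+ 2 / D ^+ 2) * (x - y) 0 i ^+ 2.
  rewrite /mddlnrho dot_aa dot_bb dot_a dot_b yw -/A -/B.
  have -> : y 0 i = x 0 i - (x - y) 0 i by rewrite !mxE; ring.
  set wi := (x - y) 0 i; field.
  by rewrite A0 B0 D0.
under eq_bigr do rewrite mdE.
rewrite sum_quadratic xx xw -/D; field.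
by [].
Qed.

End AtAPair.

(** At an interior maximum off the diagonal the strict part of the differential
    inequality for [profile] has to be compensated by the contribution of the
    logarithmic barrier, whose image under the operator is at most [8 * n]. *)
Lemma hyperbolic_max u g H k eta eps x y :
  n = k.+1 -> (2 <= k)%N -> 0 <= eta -> 0 <= eps ->
  jet2_on (unit_ball R n) u g H ->
  (forall z, unit_ball R n z ->
     rho z * \sum_i H i i z + 2 * (n%:R - 2) * gradv g z z = 0) ->
  unit_ball R n x -> unit_ball R n y -> x != y ->
  (forall a b, \forall s \near (0 : R),
     doubled u k eta eps (x + s *: a) (y + s *: b) <= doubled u k eta eps x y) ->
  eta * n%:R * expdist (psi x y) ^+ n <= n%:R * eps.
Proof.
move=> nk k2 eta0 eps0 uj hyp Bx By xy hmax.
have A0 := (unit_ball_rho x).1 Bx; have B0 := (unit_ball_rho y).1 By.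
have D0 : 0 < dotv (x - y) (x - y).
  by rewrite lt_neqAle eq_sym dotv_eq0 subr_eq0 xy dotv_ge0.
have p0 : 0 < psi x y by rewrite divr_gt0 // mulr_gt0.
have [F2 dF2 super] := profile_supersol k2 eta0 p0.
have var a b := doubled_variation uj Bx By xy dF2 (hmax a b).
set A := rho x in A0 *; set B := rho y in B0 *; set D := dotv _ _ in D0 *.
set p := psi x y in p0 dF2 super var *.
pose a i := row i (A%:M : 'M[R]_n); pose b i := row i (B *: reflm (x - y)).
have sumH : A ^+ 2 * \sum_i H i i x - B ^+ 2 * \sum_i H i i y <=
   \sum_i (2 * (F2 * (p * dlnpsi x y (a i) (b i)) ^+ 2
         + profile' k eta p
           * (p * (dlnpsi x y (a i) (b i) ^+ 2 + ddlnpsi x y (a i) (b i))))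
    + eps * (mddlnrho x (a i) + mddlnrho y (b i))).
  rewrite -(@sum_hessv_rows _ _ H x A%:M); last first.
    by rewrite tr_scalar_mx -scalar_mxM expr2.
  rewrite -(@sum_hessv_rows _ _ H y (B *: reflm (x - y))); last first.
    have -> : (B *: reflm (x - y))^T = B *: reflm (x - y).
      by rewrite linearZ /= reflm_tr.
    rewrite -scalemxAl -scalemxAr reflm_sqr ?gt_eqF //.
    by rewrite scalerA scalemx1 expr2.
  by rewrite -sumrB; apply: ler_sum => i _; case: (var (a i) (b i)).
have [drift _] := var (A *: x) (B *: y).
have e1 := hyp x Bx; have e2 := hyp y By; rewrite -/A in e1; rewrite -/B in e2.
have gZ z c : gradv g z (c *: z) = c * gradv g z z.
  by rewrite /gradv mulr_sumr; apply: eq_bigr => i _; rewrite mxE mulrA.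
rewrite !gZ in drift.
have lhsE : A ^+ 2 * \sum_i H i i x - B ^+ 2 * \sum_i H i i y =
  - (2 * (n%:R - 2)) * (A * gradv g x x - B * gradv g y y).
  transitivity (A * (A * \sum_i H i i x) - B * (B * \sum_i H i i y)); first by ring.
  have -> : A * \sum_i H i i x = - (2 * (n%:R - 2) * gradv g x x) by lra.
  have -> : B * \sum_i H i i y = - (2 * (n%:R - 2) * gradv g y y) by lra.
  by ring.
rewrite {}lhsE {}drift in sumH.
rewrite big_split /= -!mulr_sumr big_split /= -!mulr_sumr in sumH.
have sq : \sum_i (p * dlnpsi x y (a i) (b i)) ^+ 2
   = p ^+ 2 * \sum_i dlnpsi x y (a i) (b i) ^+ 2.
  by rewrite mulr_sumr; apply: eq_bigr => i _; rewrite exprMn.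
rewrite sq [\sum_i (_ + ddlnpsi _ _ _ _)]big_split /= in sumH.
have s1 : \sum_i dlnpsi x y (a i) (b i) ^+ 2 = 16 * (1 + A * B / D).
  exact: sum_dlnpsi_sqr.
have s2 : \sum_i ddlnpsi x y (a i) (b i) = 8 * (n%:R - 1) - 8 * A * B / D
    - 2 * (n%:R - 2) * dlnpsi x y (A *: x) (B *: y).
  by rewrite -(sum_ddlnpsi Bx By xy) addrK.
have s3 : \sum_i (mddlnrho x (a i) + mddlnrho y (b i))
   = 2 * n%:R * (A + B) + 8 - 4 * (A + B) by exact: sum_mddlnrho.
rewrite s1 s2 s3 !dotvZr in sumH.
have xx : dotv x x = 1 - A by rewrite /A /rho; ring.
have yy : dotv y y = 1 - B by rewrite /B /rho; ring.
rewrite xx yy -/A -/B in sumH.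
have [An Bn] : A != 0 /\ B != 0 by rewrite !gt_eqF.
have cA : 2 * (A * (1 - A)) / A = 2 * (1 - A) by field.
have cB : 2 * (B * (1 - B)) / B = 2 * (1 - B) by field.
have pn : p != 0 by rewrite gt_eqF.
have pE : A * B / D = p^-1 by rewrite /p /psi -/A -/B -/D invf_div.
have pE' : 8 * A * B / D = 8 * p^-1 by rewrite -pE; ring.
rewrite cA cB pE pE' in sumH.
set L := dlnpsi _ _ _ _ in sumH; set F1 := profile' _ _ _ in sumH super.
have kn : n%:R = k%:R + 1 :> R by rewrite nk -natr1.
rewrite nk -nk in super *.
have {}sumH : 0 <= 8 * (4 * p * (1 + p) * F2 + (2 + 2 * (k%:R + 2) * p) * F1)
   + eps * ((n%:R - 2) * (8 - 2 * (A + B)) + 8).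
  rewrite -subr_ge0 in sumH; apply: le_trans sumH _; rewrite le_eqVlt.
  apply/orP; left; apply/eqP; rewrite kn; field.
  by [].
have n2 : 0 <= n%:R - 2 :> R by rewrite subr_ge0 ler_nat nk ltnW.
have : 0 <= eps * ((n%:R - 2) * (2 * (A + B))).
  by rewrite !mulr_ge0 // addr_ge0 // ltW.
lra.
Qed.

End Supersolution.

(** * The gradient bound for hyperbolic harmonic functions *)

Section HyperbolicBound.
Context {R : realType} {n : nat}.
Implicit Types (x y : 'rV[R]_n).

Lemma rho_le1 x : rho x <= 1.
Proof. by rewrite /rho lerBlDr lerDl dotv_ge0. Qed.

Lemma rho_continuous : continuous (@rho R n).
Proof.
move=> x; apply: (@continuous_comp _ _ _ (fun x => dotv x x) (fun t : R => 1 - t)).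
  by apply: dotv_continuous; exact: cvg_id.
by apply: cvgB; [exact: cvg_cst | exact: cvg_id].
Qed.

Lemma psi_ge0 x y : 0 < rho x -> 0 < rho y -> 0 <= psi x y.
Proof. by move=> A0 B0; rewrite divr_ge0 ?dotv_ge0 // mulr_ge0 // ltW. Qed.

Lemma rho_ge_compact (d : R) : 0 <= d -> compact [set x : 'rV[R]_n | d <= rho x].
Proof.
move=> d0.
have cl : closed [set x : 'rV[R]_n | d <= rho x].
  apply: (closed_comp (f := @rho R n) (D := [set t | d <= t])).
    by move=> x _; exact: rho_continuous.
  exact: closed_ge.
apply: (subclosed_compact cl (@enorm_le_compact R n 1)) => x /= dx.
rewrite -(@ler_pXn2r _ 2) ?nnegrE ?enorm_ge0 // enorm_sqr expr1n.
by move: (le_trans d0 dx); rewrite /rho subr_ge0.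
Qed.

Lemma doubled_continuous u g H k eta eps x y :
  jet2_on (unit_ball R n) u g H -> unit_ball R n x -> unit_ball R n y ->
  {for (x, y), continuous (fun q => doubled u k eta eps q.1 q.2)}.
Proof.
move=> uj Bx By.
have A0 := (unit_ball_rho x).1 Bx; have B0 := (unit_ball_rho y).1 By.
have c1 : {for (x, y), continuous (fst : 'rV[R]_n * 'rV[R]_n -> 'rV[R]_n)}.
  exact: cvg_fst.
have c2 : {for (x, y), continuous (snd : 'rV[R]_n * 'rV[R]_n -> 'rV[R]_n)}.
  exact: cvg_snd.
have cr1 : {for (x, y), continuous (fun q : 'rV[R]_n * 'rV[R]_n => rho q.1)}.
  by apply: continuous_comp c1 _; exact: rho_continuous.
have cr2 : {for (x, y), continuous (fun q : 'rV[R]_n * 'rV[R]_n => rho q.2)}.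
  by apply: continuous_comp c2 _; exact: rho_continuous.
have cw : {for (x, y), continuous (fun q : 'rV[R]_n * 'rV[R]_n => q.1 - q.2)}.
  exact: cvgB.
have cp : {for (x, y), continuous (fun q : 'rV[R]_n * 'rV[R]_n => psi q.1 q.2)}.
  apply: cvgM; first exact: (dotv_continuous cw cw).
  apply: cvgV; first by rewrite gt_eqF // mulr_gt0.
  exact: cvgM.
rewrite /doubled; apply: cvgD; last first.
  apply: cvgM; first exact: cvg_cst.
  apply: cvgD.
    by apply: continuous_comp cr1 _; exact: continuous_ln.
  by apply: continuous_comp cr2 _; exact: continuous_ln.
apply: cvgB; last first.
  apply: cvgM; first exact: cvg_cst.
  apply: continuous_comp cp _; apply: profile_continuous; exact: psi_ge0.
apply: cvgB.
  by apply: continuous_comp c1 _; exact: has_grad_continuous (jet_grad uj Bx).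
by apply: continuous_comp c2 _; exact: has_grad_continuous (jet_grad uj By).
Qed.

Section Comparison.
Variables (u : 'rV[R]_n -> R) (g : 'I_n -> 'rV[R]_n -> R).
Variables (H : 'I_n -> 'I_n -> 'rV[R]_n -> R) (k : nat).
Hypotheses (nk : n = k.+1) (k2 : (2 <= k)%N).
Hypothesis uj : jet2_on (unit_ball R n) u g H.
Hypothesis hyp : forall z, unit_ball R n z ->
  rho z * \sum_i H i i z + 2 * (n%:R - 2) * gradv g z z = 0.
Hypothesis u1 : forall z, unit_ball R n z -> `|u z| <= 1.

(** If the estimate failed, then for small [eps] the function [doubled] would have
    a positive maximum: near the boundary the logarithms beat [2], the bound for
    [u x - u y]. It is off the diagonal, where [doubled] is not positive, and at
    a distance where [profile] is below [1]; this contradicts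
    [hyperbolic_max] as soon as [eps] is small enough. *)
Lemma osc_le_profile_eta eta x y : 0 < eta ->
  unit_ball R n x -> unit_ball R n y -> u x - u y <= 2 * profile k eta (psi x y).
Proof.
move=> eta0 Bx By; rewrite leNgt; apply/negP => gap.
have u2 a b : unit_ball R n a -> unit_ball R n b -> u a - u b <= 2.
  move=> /u1; rewrite ler_norml => /andP[_ a1] /u1; rewrite ler_norml => /andP[b1 _].
  lra.
have lnr (a : 'rV[R]_n) : ln (rho a) <= 0 by exact/ln_le0/rho_le1.
set z1 := eta / (2 + eta).
have z10 : 0 < z1 by rewrite divr_gt0 // addr_gt0.
pose L := ln (rho x) + ln (rho y).
have L0 : L <= 0 by rewrite /L; have := lnr x; have := lnr y; lra.
pose m := u x - u y - 2 * profile k eta (psi x y).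
have m0 : 0 < m by rewrite subr_gt0.
(* The first entry keeps the value at [(x, y)] positive, the second one
   contradicts [hyperbolic_max] at distances where [expdist] exceeds [z1]. *)
pose eps := Num.min (m / (2 * (1 - L))) (eta * z1 ^+ n / 2).
have ez : 0 < eta * z1 ^+ n by rewrite mulr_gt0 // exprn_gt0.
have eps0 : 0 < eps.
  rewrite lt_min; apply/andP; split; last by rewrite divr_gt0.
  rewrite divr_gt0 // mulr_gt0 //; lra.
have epsm : eps * - L < m.
  have : eps <= m / (2 * (1 - L)) by rewrite ge_min lexx.
  rewrite ler_pdivlMr; last lra.
  nra.
have epsz : eps < eta * z1 ^+ n.
  have : eps <= eta * z1 ^+ n / 2 by rewrite ge_min lexx orbT.
  lra.
(* Below this value of [rho] the barrier alone outweighs the oscillation of [u]. *)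
pose d := expR (- (2 / eps)).
have d0 : 0 < d by exact: expR_gt0.
have inK a b : unit_ball R n a -> unit_ball R n b ->
    0 < doubled u k eta eps a b -> d < rho a /\ d < rho b.
  move=> Ba Bb; rewrite /doubled => pos.
  have a0 := (unit_ball_rho a).1 Ba; have b0 := (unit_ball_rho b).1 Bb.
  have f0 : 0 <= profile k eta (psi a b).
    by apply: profile_ge0; [exact: ltW | exact: psi_ge0].
  have := u2 a b Ba Bb; have la := lnr a; have lb := lnr b => ub.
  have key (t : R) : 0 < t -> - 2 < eps * ln t -> d < t.
    move=> t0 et; rewrite -[t]lnK ?posrE // ltr_expR -mulNr ltr_pdivrMr //.
    by rewrite mulrC.
  have ea : eps * ln (rho a) <= 0 by rewrite pmulr_rle0.
  have eb : eps * ln (rho b) <= 0 by rewrite pmulr_rle0.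
  rewrite [eps * _]mulrDr in pos.
  by split; apply: key => //; lra.
pose K := [set a : 'rV[R]_n | d <= rho a].
have cK : compact (K `*` K) by apply: compact_setX; apply: rho_ge_compact; exact: ltW.
have BK a : K a -> unit_ball R n a.
  by move=> Ka; apply/unit_ball_rho; exact: lt_le_trans Ka.
have pos : 0 < doubled u k eta eps x y.
  have -> : doubled u k eta eps x y = m + eps * L by [].
  lra.
have [dx dy] := inK x y Bx By pos.
have K0 : (K `*` K) !=set0 by exists (x, y); split; exact: ltW.
have [|[x0 y0]] := compact_EVT_max (f := fun q => doubled u k eta eps q.1 q.2) K0 cK.
  apply: continuous_in_subspaceT => -[a b] /set_mem [/= /BK Ba /BK Bb].
  exact: doubled_continuous uj Ba Bb.
move=> /set_mem [/= Kx0 Ky0] mx.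
have Bx0 := BK _ Kx0; have By0 := BK _ Ky0.
have pos0 : 0 < doubled u k eta eps x0 y0.
  apply: lt_le_trans pos _; apply: (mx (x, y)); apply/mem_set.
  by split; exact: ltW.
have [dx0 dy0] := inK x0 y0 Bx0 By0 pos0.
have p0 : 0 <= psi x0 y0 by apply: psi_ge0; exact/unit_ball_rho.
have f0 : 0 <= profile k eta (psi x0 y0) by apply: profile_ge0 => //; exact: ltW.
have el : eps * (ln (rho x0) + ln (rho y0)) <= 0.
  by rewrite pmulr_rle0 //; have := lnr x0; have := lnr y0; lra.
have xy : x0 != y0.
  apply/eqP => e; move: pos0; rewrite /doubled.
  have -> : u x0 = u y0 by rewrite e.
  lra.
have zz : z1 < expdist (psi x0 y0).
  rewrite ltNge; apply/negP => /(@profile_ge1 _ k eta _ (ltnW k2) eta0 p0) f1.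
  move: pos0; rewrite /doubled; have := u2 x0 y0 Bx0 By0; lra.
have near_K (a c : 'rV[R]_n) : d < rho a -> \forall s \near (0 : R), d <= rho (a + s *: c).
  move=> da.
  have : \forall s \near (0 : R), 0 < quad (rho a - d) (- 2 * dotv a c) (- 2 * dotv c c) s.
    by apply: near_quad_gt0; rewrite subr_gt0.
  by apply: filterS => s; rewrite rho_line /quad; lra.
have := @hyperbolic_max R n u g H k eta eps x0 y0 nk k2 (ltW eta0) (ltW eps0)
  uj hyp Bx0 By0 xy.
have mxl a b : \forall s \near (0 : R),
    doubled u k eta eps (x0 + s *: a) (y0 + s *: b) <= doubled u k eta eps x0 y0.
  have nx := near_K x0 a dx0; have ny := near_K y0 b dy0; near=> s.
  have xs : d <= rho (x0 + s *: a) by near: s.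
  have ys : d <= rho (y0 + s *: b) by near: s.
  apply: (mx (x0 + s *: a, y0 + s *: b)); apply/mem_set; by split.
move=> /(_ mxl); apply/negP; rewrite -ltNge.
have n0 : 0 < n%:R :> R by rewrite nk.
rewrite mulrAC [eta * _ * _]mulrC ltr_pM2l //.
apply: lt_le_trans epsz _; rewrite ler_pM2l //.
by apply: lerXn2r; rewrite ?nnegrE // ltW // expdist_gt0.
Unshelve. all: by end_near. Qed.

Lemma osc_le_profile x y : unit_ball R n x -> unit_ball R n y ->
  u x - u y <= 2 * profile k 0 (psi x y).
Proof.
move=> Bx By; apply/ler_addgt0Pr => e e0.
have p0 : 0 <= psi x y by apply: psi_ge0; exact/unit_ball_rho.
have e4 : 0 < e / 4 by rewrite divr_gt0.
apply: le_trans (osc_le_profile_eta e4 Bx By) _.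
have z0 := expdist_gt0 p0; have z1 := expdist_le1 p0.
have zj j : 0 < expdist (psi x y) ^+ j <= 1 by rewrite exprn_gt0 // exprn_ile1 // ltW.
have /andP[a0 a1] := zj k; have /andP[b0 b1] := zj k.+1.
rewrite /profile; set P := _ ^+ k in a0 a1 *; set Q := _ ^+ k.+1 in b0 b1 *.
have T1 : (1 - P) / (1 + P) <= 1 by rewrite ler_pdivrMr; lra.
have T0 : 0 <= (1 - P) / (1 + P) by rewrite divr_ge0; lra.
set T := (1 - P) / (1 + P) in T0 T1 *.
have : e * T <= e by rewrite ler_piMr // ltW.
have : e * (1 - Q) <= e by rewrite ler_piMr //; lra.
lra.
Qed.

(** With [z = exp (- s)], this is [tanh (j * s / 2) <= j * tanh (s / 2)]; it
    follows from the addition formula for [tanh]. *)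
Lemma tanh_subadditive (z : R) j : 0 < z <= 1 ->
  (1 - z ^+ j) / (1 + z ^+ j) <= j%:R * ((1 - z) / (1 + z)).
Proof.
move=> /andP[z0 z1]; elim: j => [|j ih]; first by rewrite expr0 subrr !mul0r.
have P0 : 0 < z ^+ j by rewrite exprn_gt0.
have P1 : z ^+ j <= 1 by rewrite exprn_ile1 // ltW.
rewrite -natr1 [leRHS]mulrDl mul1r exprSr.
apply: (le_trans _ (lerD ih (lexx _))); set P := z ^+ j in P0 P1 *.
rewrite -subr_ge0.
have -> : (1 - P) / (1 + P) + (1 - z) / (1 + z) - (1 - P * z) / (1 + P * z)
  = (1 - P) * (1 - z) * (1 - P * z) / ((1 + P) * (1 + z) * (1 + P * z)).
  have Pz : 0 < P * z by rewrite mulr_gt0.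
  by field; rewrite !gt_eqF //; lra.
have Pz : 0 < P * z by rewrite mulr_gt0.
have Pz1 : P * z <= 1 by rewrite mulr_ile1 // ltW.
apply: divr_ge0; first by rewrite !mulr_ge0 ?subr_ge0.
by rewrite !mulr_ge0 // addr_ge0 // ltW.
Qed.

(** This is [2 * tanh (k * s / 2) <= k * sinh s], through
    [tanh (s / 2) <= sinh s / 2]. *)
Lemma profile_le_sqrt (p : R) : 0 <= p -> 2 * profile k 0 p <= k%:R * Num.sqrt p.
Proof.
move=> p0; have z0 := expdist_gt0 p0; have z1 := expdist_le1 p0.
have zz : 0 < expdist p <= 1 by rewrite z0.
rewrite /profile addr0 mul1r mul0r addr0.
apply: le_trans (ler_wpM2l _ (tanh_subadditive k zz)) _ => //.
rewrite mulrCA ler_wpM2l //.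
have := expdist_mul p0; set z := expdist p in z0 z1 *.
have bz : Num.sqrt (1 + p) = z + Num.sqrt p by rewrite /z /expdist subrK.
rewrite bz; set b := Num.sqrt p => e.
rewrite mulrA ler_pdivrMr; last lra.
rewrite -(ler_pM2l z0).
have zb : z * b = (1 - z ^+ 2) / 2 by lra.
rewrite [leRHS]mulrA zb.
have : 0 <= (1 - z) * ((1 - z) ^+ 2) by rewrite mulr_ge0 ?sqr_ge0 // subr_ge0.
nra.
Qed.

(** The two-point estimate along a short segment in direction [e], divided by
    its length. *)
Theorem hyperbolic_gradient_bound x e : unit_ball R n x -> dotv e e = 1 ->
  gradv g x e <= k%:R / rho x.
Proof.
move=> Bx e1; have A0 := (unit_ball_rho x).1 Bx.
have Bx0 : unit_ball R n (x + (0 : R) *: e) by rewrite scale0r addr0.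
have [d _] := jet_line uj Bx0; rewrite scale0r addr0 in d.
pose r (s : R) := quad (rho x) (- 2 * dotv x e) (- 2 * dotv e e) s.
have rE s : rho (x + s *: e) = r s by rewrite rho_line.
pose h (s : R) := k%:R / Num.sqrt (r s * rho x).
have h0 : h 0 = k%:R / rho x.
  by rewrite /h /r quad0 -expr2 sqrtr_sqr gtr0_norm.
rewrite -h0.
have cr : {for (0 : R), continuous r}.
  apply/differentiable_continuous/derivable1_diffP.
  by have [] := is_derive_quad (rho x) (- 2 * dotv x e) (- 2 * dotv e e) 0.
apply: deriv_le_right d _ _.
  apply: cvgM; first exact: cvg_cst.
  apply: cvgV; first by rewrite sqrtr_eq0 -ltNge /r quad0 mulr_gt0.
  apply: (@continuous_comp _ _ _ (fun s => r s * rho x) Num.sqrt).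
    by apply: cvgM; [exact: cr | exact: cvg_cst].
  exact: sqrt_continuous.
have rpos : \forall s \near (0 : R), 0 < r s by exact: near_quad_gt0.
have {}rpos : \forall s \near (0 : R)^'+, 0 < r s by apply: cvg_within; exact: rpos.
near=> s.
have s0 : 0 < s by near: s; exact: nbhs_right_gt.
have rs : 0 < r s by near: s.
have Bs : unit_ball R n (x + s *: e) by apply/unit_ball_rho; rewrite rE.
rewrite scale0r addr0.
apply: le_trans (osc_le_profile Bs Bx) _.
apply: le_trans (profile_le_sqrt (psi_ge0 _ A0)) _; first by rewrite rE.
rewrite /psi rE addrAC subrr add0r !dotvE e1 mulr1 -expr2.
rewrite sqrtrM ?sqr_ge0 // sqrtr_sqr gtr0_norm // sqrtrV; last first.
  by rewrite mulr_ge0 // ltW.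
by rewrite /h mulrCA.
Unshelve. all: by end_near. Qed.

End Comparison.

End HyperbolicBound.

(** * Uniform continuity and Riemann sums *)

Section RiemannSum.
Context {R : realType}.

Lemma compact_unif_continuous (T : pseudoMetricType R) (K : set T) (f : T -> R)
    (eta : R) : compact K -> (forall x, K x -> {for x, continuous f}) -> 0 < eta ->
  exists2 w : R, 0 < w & forall x y, K x -> ball x w y -> `|f x - f y| < eta.
Proof.
move=> /compact_near_coveringP cK cf eta0.
have := @cK R (0 : R)^'+ (fun w x => forall y, ball x w y -> `|f x - f y| < eta) _.
case.
  move=> x Kx.
  have e2 : 0 < eta / 2 by rewrite divr_gt0.
  have /cvgrPdist_lt /(_ _ e2) /nbhs_ballP [r /= r0 hr] := cf x Kx.
  have r2 : 0 < r / 2 by rewrite divr_gt0.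
  exists (ball x (r / 2), [set w | w < r / 2]) => /=.
    by split; [exact: nbhsx_ballx | exact: nbhs_right_lt].
  move=> -[x' w] /= [bx' wr] y yw.
  have h1 : `|f x - f x'| < eta / 2.
    by apply: hr; apply: le_ball bx'; lra.
  have h2 : `|f x - f y| < eta / 2.
    apply: hr; apply: le_ball (ball_triangle bx' yw); lra.
  rewrite (splitr eta) -(subrKA (f x)) (le_lt_trans (ler_normD _ _)) // ltrD //.
  by rewrite distrC.
move=> r0 /= r00 hr; exists (r0 / 2); first by rewrite divr_gt0.
move=> x y Kx; apply: hr => //=; last by rewrite divr_gt0.
by rewrite sub0r normrN gtr0_norm ?divr_gt0 // ltr_pdivrMr // ltr_pMr // ltr1n.
Qed.

(** On each subinterval the mean value theorem replaces the increment of [F] by a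
    value of [f], so uniform continuity of [f] suffices and no integral is
    involved. *)
Lemma riemann_sum_error (F f : R -> R) (a b eta : R) (N : nat) (h := (b - a) / N%:R) :
  (0 < N)%N -> a < b ->
  (forall t, a <= t <= b -> is_derive t 1 F (f t)) ->
  (forall s t, a <= s <= b -> a <= t <= b -> `|s - t| <= h -> `|f s - f t| <= eta) ->
  `|\sum_(m < N) h * f (a + m%:R * h) - (F b - F a)| <= (b - a) * eta.
Proof.
move=> N0 ab dF uf.
have N0' : 0 < N%:R :> R by rewrite ltr0n.
have h0 : 0 < h by rewrite divr_gt0 // subr_gt0.
pose t_ (m : nat) := a + m%:R * h.
have tS m : t_ m.+1 = t_ m + h by rewrite /t_ -natr1; ring.
have hN : N%:R * h = b - a by rewrite mulrC divfK ?gt_eqF.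
have tN : t_ N = b by rewrite /t_ hN addrC subrK.
have ta m : a <= t_ m by rewrite lerDl mulr_ge0 // ltW.
have tb m : (m <= N)%N -> t_ m <= b.
  by move=> mN; rewrite -tN lerD2l ler_wpM2r ?ler_nat // ltW.
have -> : F b - F a = \sum_(m < N) (F (t_ m.+1) - F (t_ m)).
  rewrite -(big_mkord xpredT (fun m => F (t_ m.+1) - F (t_ m))).
  by rewrite telescope_sumr // tN /t_ mul0r addr0.
rewrite -sumrB; apply: le_trans (ler_norm_sum _ _ _) _.
have -> : (b - a) * eta = \sum_(m < N) h * eta.
  by rewrite sumr_const card_ord -[RHS]mulr_natl mulrA hN.
apply: ler_sum => -[m mN] _ /=.
have lt : t_ m < t_ m.+1 by rewrite tS ltrDl.
have in_ab t : t_ m <= t <= t_ m.+1 -> a <= t <= b.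
  by move=> /andP[t1 t2]; rewrite (le_trans (ta m) t1) (le_trans t2 (tb _ mN)).
have [c cin ->] : exists2 c, c \in `]t_ m, t_ m.+1[%R &
    F (t_ m.+1) - F (t_ m) = f c * (t_ m.+1 - t_ m).
  apply: MVT => // [t|].
    by rewrite in_itv /= => /andP[t1 t2]; apply/dF/in_ab; rewrite !ltW.
  apply: derivable_within_continuous => t; rewrite in_itv /= => tt.
  by case: (dF t (in_ab t tt)).
move: cin; rewrite in_itv /= => /andP[c1 c2].
rewrite tS addrAC subrr add0r [f c * h]mulrC -mulrBr normrM gtr0_norm //.
apply: ler_wpM2l; first exact: ltW.
apply: uf.
- by apply/in_ab; rewrite lexx ltW.
- by apply/in_ab; rewrite !ltW.
- by rewrite distrC gtr0_norm ?subr_gt0 // lerBlDl -tS ltW.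
Qed.

End RiemannSum.

(** * Second variation on the sphere *)

Section SphereVariation.
Context {R : realType} {n : nat}.
Implicit Types (x z e : 'rV[R]_n).

(** Up to sign, [rot_radial] is the acceleration at time [0] of [rot_curve], the
    orbit of [z] under rotations of the plane of coordinates [i] and [j]. The sum
    of the second derivatives over all pairs of coordinates is the Laplacian of
    the sphere, which avoids orthonormal frames of tangent spaces. *)
Definition rot_radial z (i j : 'I_n) : 'rV[R]_n :=
  z 0 i *: delta_mx 0 i + z 0 j *: delta_mx 0 j.

Definition rot_tangent z (i j : 'I_n) : 'rV[R]_n :=
  z 0 i *: delta_mx 0 j - z 0 j *: delta_mx 0 i.

Definition rot_curve z i j (s : R) : 'rV[R]_n :=
  z + (cos s - 1) *: rot_radial z i j + sin s *: rot_tangent z i j.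

Lemma dotv_delta x i : dotv x (delta_mx 0 i) = x 0 i.
Proof.
rewrite /dotv (bigD1 i) //= big1 => [|j ji]; first by rewrite mxE !eqxx mulr1 addr0.
by rewrite mxE (negbTE ji) andbF mulr0.
Qed.

Lemma gradvZ g z a (c : R) : gradv g z (c *: a) = c * gradv g z a.
Proof. by rewrite /gradv mulr_sumr; apply: eq_bigr => i _; rewrite mxE mulrA. Qed.

Lemma gradvD g z a b : gradv g z (a + b) = gradv g z a + gradv g z b.
Proof. by rewrite /gradv -big_split; apply: eq_bigr => i _; rewrite mxE mulrDl. Qed.

Lemma gradvB g z a b : gradv g z (a - b) = gradv g z a - gradv g z b.
Proof. by rewrite gradvD -scaleN1r gradvZ mulN1r. Qed.

Lemma gradv_delta g z i : gradv g z (delta_mx 0 i) = g i z.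
Proof.
rewrite /gradv (bigD1 i) //= big1 => [|j ji]; first by rewrite mxE !eqxx mul1r addr0.
by rewrite mxE (negbTE ji) andbF mul0r.
Qed.

Lemma hessvE H z a :
  hessv H z a = gradv (fun j z => gradv (fun i => H i j) z a) z a.
Proof. by []. Qed.

Lemma rot_curve_norm z i j s : i != j ->
  dotv (rot_curve z i j s) (rot_curve z i j s) = dotv z z.
Proof.
move=> ij; have ji : j != i by rewrite eq_sym.
rewrite /rot_curve /rot_radial /rot_tangent !dotvE.
rewrite !(dotvC (delta_mx _ _) z) !dotv_delta !mxE !eqxx (negbTE ij) (negbTE ji) /=.
have := cos2Dsin2 s => cs.
set c := cos s in cs *; set t := sin s in cs *.
set p := z 0 i; set q := z 0 j; set d := dotv z z.
have e : t ^+ 2 = 1 - c ^+ 2 by rewrite -cs; ring.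
apply/eqP; rewrite -subr_eq0; apply/eqP.
transitivity ((p ^+ 2 + q ^+ 2) * (c ^+ 2 + t ^+ 2 - 1)); first by rewrite /=; ring.
by rewrite e; ring.
Qed.

Lemma rot_curve_variation A u g H z i j : jet2_on A u g H ->
  (forall s : R, A (rot_curve z i j s)) ->
  exists2 du : R -> R,
    forall s : R, is_derive s 1 (u \o rot_curve z i j) (du s) &
    is_derive (0 : R) 1 du (hessv H z (rot_tangent z i j) - gradv g z (rot_radial z i j)).
Proof.
move=> uj Ac.
set P := rot_radial z i j; set B := rot_tangent z i j.
pose c' (s : R) := (- sin s) *: P + cos s *: B.
have dc (s : R) l : is_derive s 1 (fun s => rot_curve z i j s 0 l) (c' s 0 l).
  have -> : (fun s => rot_curve z i j s 0 l) =
      (fun s : R => z 0 l + (cos s - 1) * P 0 l + sin s * B 0 l).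
    by apply/funext => r; rewrite !mxE.
  apply: is_derive_eq; rewrite /GRing.scale /= !mxE; ring.
exists (fun s => \sum_(l < n) c' s 0 l * g l (rot_curve z i j s)).
  by move=> s; exact: is_derive_curve (jet_grad uj (Ac s)) (dc s).
have c0 : rot_curve z i j 0 = z.
  by rewrite /rot_curve cos0 sin0 subrr !scale0r !addr0.
have d1 l : is_derive (0 : R) 1 (g l \o rot_curve z i j) (gradv (H l) z (c' 0)).
  have := is_derive_curve (jet_hess uj l (Ac 0)) (dc 0).
  by rewrite /gradv c0.
have d2 l : is_derive (0 : R) 1 (fun s => c' s 0 l) (- P 0 l).
  have -> : (fun s => c' s 0 l) = (fun s => - sin s * P 0 l + cos s * B 0 l).
    by apply/funext => r; rewrite !mxE.
  by apply: is_derive_eq; rewrite /GRing.scale /= cos0 sin0; ring.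
have d3 l : is_derive (0 : R) 1 (fun s => c' s 0 l * g l (rot_curve z i j s))
   (c' 0 0 l * gradv (H l) z (c' 0) - g l z * P 0 l).
  have := is_deriveM (d2 l) (d1 l); rewrite /GRing.scale /= c0 mulrN; exact.
have -> : (fun s => \sum_(l < n) c' s 0 l * g l (rot_curve z i j s))
   = \sum_(l < n) (fun s => c' s 0 l * g l (rot_curve z i j s)).
  by apply/funext => s; rewrite fct_sumE.
apply: is_derive_eq.
have c'0 : c' 0 = B by rewrite /c' sin0 cos0 oppr0 scale0r add0r scale1r.
rewrite sumrB c'0; congr (_ - _); last by apply: eq_bigr => l _; rewrite mulrC.
rewrite /hessv /gradv; under [RHS]eq_bigr do rewrite mulr_sumr.
rewrite exchange_big; apply: eq_bigr => l _ /=; rewrite mulr_sumr.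
by apply: eq_bigr => m _; ring.
Qed.

Lemma sum_rot_radial g z :
  \sum_(i < n) \sum_(j < n | j != i) gradv g z (rot_radial z i j)
  = 2 * (n%:R - 1) * gradv g z z.
Proof.
have gE i j : gradv g z (rot_radial z i j) = z 0 i * g i z + z 0 j * g j z.
  by rewrite gradvD !gradvZ !gradv_delta.
have S i : \sum_(j < n | j != i) gradv g z (rot_radial z i j)
   = (n%:R - 2) * (z 0 i * g i z) + gradv g z z.
  under eq_bigr do rewrite gE.
  rewrite big_split /= sumr_const.
  have -> : #|[pred j : 'I_n | j != i]| = n.-1.
    by rewrite -[in RHS](card_ord n) (cardC1 i).
  have -> : gradv g z z = z 0 i * g i z + \sum_(j < n | j != i) z 0 j * g j z.
    by rewrite /gradv (bigD1 i).
  have n1 : n.-1%:R = n%:R - 1 :> R.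
    by case: (n) i => [[]//|k _]; rewrite -natr1 addrK.
  by rewrite -[_ *+ n.-1]mulr_natl n1; ring.
under eq_bigr do rewrite S.
rewrite big_split /= -mulr_sumr sumr_const card_ord -/(gradv g z z) -mulr_natl.
by ring.
Qed.

Lemma sum_rot_tangent H z : dotv z z = 1 ->
  \sum_(i < n) \sum_(j < n | j != i) hessv H z (rot_tangent z i j)
  = 2 * (\sum_(i < n) H i i z - hessv H z z).
Proof.
move=> z1.
have hE i j : hessv H z (rot_tangent z i j) =
    (z 0 i ^+ 2 * H j j z + z 0 j ^+ 2 * H i i z)
    - (z 0 i * (z 0 j * H i j z) + z 0 j * (z 0 i * H j i z)).
  by rewrite hessvE /rot_tangent !(gradvB, gradvZ, gradv_delta); ring.
have -> : \sum_(i < n) \sum_(j < n | j != i) hessv H z (rot_tangent z i j)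
  = \sum_(i < n) \sum_(j < n) hessv H z (rot_tangent z i j).
  apply: eq_bigr => i _; rewrite [RHS](bigD1 i) //=.
  by rewrite hE [X in X + _](_ : _ = 0) ?add0r //; ring.
under eq_bigr do under eq_bigr do rewrite hE.
under eq_bigr do rewrite sumrB !big_split /=.
rewrite sumrB !big_split /=.
have zz : \sum_(i < n) z 0 i ^+ 2 = 1.
  by rewrite -z1; apply: eq_bigr => i _; rewrite expr2.
have e1 : \sum_(i < n) \sum_(j < n) z 0 i ^+ 2 * H j j z = \sum_(i < n) H i i z.
  under eq_bigr do rewrite -mulr_sumr.
  by rewrite -mulr_suml zz mul1r.
have e2 : \sum_(i < n) \sum_(j < n) z 0 j ^+ 2 * H i i z = \sum_(i < n) H i i z.
  by rewrite exchange_big.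
have e3 : \sum_(i < n) \sum_(j < n) z 0 i * (z 0 j * H i j z) = hessv H z z.
  rewrite exchange_big /hessv; apply: eq_bigr => j _; rewrite mulr_sumr.
  by apply: eq_bigr => i _; ring.
have e4 : \sum_(i < n) \sum_(j < n) z 0 j * (z 0 i * H j i z) = hessv H z z.
  by rewrite exchange_big.
by rewrite e1 e2 e3 e4; ring.
Qed.

(** This and the next lemma apply the two preceding ones to the linear function
    [dotv ^~ e] and to half of its square. *)
Lemma sum_rot_linear e z :
  \sum_(i < n) \sum_(j < n | j != i) dotv (rot_radial z i j) e
  = 2 * (n%:R - 1) * dotv z e.
Proof.
have gE a : dotv a e = gradv (fun i _ => e 0 i) z a by [].
under eq_bigr do under eq_bigr do rewrite gE.
by rewrite sum_rot_radial -gE.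
Qed.

Lemma sum_rot_sqr e z : dotv z z = 1 -> dotv e e = 1 ->
  \sum_(i < n) \sum_(j < n | j != i) dotv (rot_tangent z i j) e ^+ 2
  = 2 * (1 - dotv z e ^+ 2).
Proof.
move=> z1 e1.
have hE a : dotv a e ^+ 2 = hessv (fun i j _ => e 0 i * e 0 j) z a.
  rewrite /hessv expr2 {1}/dotv mulr_suml; apply: eq_bigr => j _.
  by rewrite -mulrA /dotv !mulr_sumr; apply: eq_bigr => i _; ring.
under eq_bigr do under eq_bigr do rewrite hE.
by rewrite sum_rot_tangent // -hE -e1 /dotv.
Qed.

End SphereVariation.

(** * Rays and the maximum principle on the hemisphere *)

Section RayJets.
Context {R : realType} {n : nat}.
Implicit Types (x z a e : 'rV[R]_n).

Lemma jet_ray A u g H a (s : R) : jet2_on A u g H -> A (s *: a) ->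
  is_derive s 1 (fun s => u (s *: a)) (gradv g (s *: a) a)
  /\ is_derive s 1 (fun s => gradv g (s *: a) a) (hessv H (s *: a) a).
Proof.
move=> uj As; have := @jet_line R n A u g H 0 a s uj; rewrite add0r => /(_ As).
have -> : (fun s => u (0 + s *: a)) = (fun s => u (s *: a)).
  by apply/funext => t; rewrite add0r.
have -> : (fun s => gradv g (0 + s *: a) a) = (fun s => gradv g (s *: a) a).
  by apply/funext => t; rewrite add0r.
by [].
Qed.

Lemma hessvZ (H : 'I_n -> 'I_n -> 'rV[R]_n -> R) x a (c : R) :
  hessv H x (c *: a) = c ^+ 2 * hessv H x a.
Proof.
rewrite /hessv mulr_sumr; apply: eq_bigr => j _; rewrite mxE.
rewrite !mulr_sumr; apply: eq_bigr => i _; rewrite mxE; ring.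
Qed.

Lemma jet2_scale A u g H (c : R) : jet2_on A u g H ->
  (forall x, A x -> A (c *: x)) ->
  jet2_on A (fun x => u (c *: x)) (fun i x => c * g i (c *: x))
    (fun i j x => c ^+ 2 * H i j (c *: x)).
Proof.
move=> uj Ac.
have cE x : 0 + x *m c%:M = c *: x by rewrite add0r mul_mx_scalar.
have sE k (f : 'I_n -> R) : \sum_(l < n) c%:M k l * f l = c * f k.
  rewrite (bigD1 k) //= big1 => [|l lk]; first by rewrite mxE eqxx mulr1n addr0.
  by rewrite mxE eq_sym (negbTE lk) mul0r.
have := @jet2_affine R n A A u g H 0 c%:M uj.
have -> : (fun y => u (0 + y *m c%:M)) = (fun x => u (c *: x)).
  by apply/funext => y; rewrite cE.
have -> : (fun k y => \sum_(l < n) c%:M k l * g l (0 + y *m c%:M))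
   = (fun i x => c * g i (c *: x)).
  by apply/funext => k; apply/funext => y; rewrite sE cE.
have -> : (fun k j y => \sum_(l < n) c%:M k l *
     \sum_(p < n) c%:M j p * H l p (0 + y *m c%:M))
   = (fun i j x => c ^+ 2 * H i j (c *: x)).
  apply/funext => k; apply/funext => j; apply/funext => y.
  by rewrite sE sE cE mulrA expr2.
by apply=> y Ay; rewrite cE; exact: Ac.
Qed.

Lemma gradv_continuous (g : 'I_n -> 'rV[R]_n -> R) (T : topologicalType)
    (f a : T -> 'rV[R]_n) t :
  (forall i, {for f t, continuous (g i)}) -> {for t, continuous f} ->
  {for t, continuous a} -> {for t, continuous (fun s => gradv g (f s) (a s))}.
Proof.
move=> cg cf ca; rewrite /continuous_at /gradv; apply: cvg_sum => i; apply: cvgM.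
  exact: (cvg_comp _ _ ca (@coord_continuous _ _ _ 0 i _)).
exact: (continuous_comp cf (cg i)).
Qed.

Lemma hessv_continuous (H : 'I_n -> 'I_n -> 'rV[R]_n -> R) (T : topologicalType)
    (f a : T -> 'rV[R]_n) t :
  (forall i j, {for f t, continuous (H i j)}) -> {for t, continuous f} ->
  {for t, continuous a} -> {for t, continuous (fun s => hessv H (f s) (a s))}.
Proof.
move=> cH cf ca; rewrite /continuous_at /hessv; apply: cvg_sum => j; apply: cvgM.
  exact: (cvg_comp _ _ ca (@coord_continuous _ _ _ 0 j _)).
exact: (@gradv_continuous (fun i => H i j) T f a t).
Qed.

Lemma sphere_compact : compact [set z : 'rV[R]_n | dotv z z = 1].
Proof.
have cl : closed [set z : 'rV[R]_n | dotv z z = 1].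
  apply: (closed_comp (f := fun z : 'rV[R]_n => dotv z z) (D := [set t | t = 1])).
    by move=> x _; apply: dotv_continuous; exact: cvg_id.
  exact: closed_eq.
apply: (subclosed_compact cl (@enorm_le_compact R n 1)) => x /= dx.
by rewrite enormE dx sqrtr1.
Qed.

End RayJets.

Section SphereMinimum.
Context {R : realType} {n : nat}.
Variables (A : set 'rV[R]_n) (G : 'rV[R]_n -> R) (g : 'I_n -> 'rV[R]_n -> R).
Variables (H : 'I_n -> 'I_n -> 'rV[R]_n -> R) (e : 'rV[R]_n).
Hypothesis Gj : jet2_on A G g H.
Hypothesis SA : forall z, dotv z z = 1 -> A z.
Hypothesis e1 : dotv e e = 1.

(** Second order condition at a point of the open hemisphere where [G] touches a
    function [q + mu * t] of the height [t] from above. The right-hand side is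
    the sphere Laplacian of [G] plus [n - 1] times [G], the left-hand side the
    same operator applied to [q]; it annihilates [mu * t], so that [mu] drops
    out. *)
Lemma sphere_min_variation (q q' : R -> R) (q'' mu : R) (z : 'rV[R]_n) :
  dotv z z = 1 -> 0 < dotv z e ->
  (forall t : R, 0 < t -> is_derive t 1 q (q' t)) ->
  is_derive (dotv z e) 1 q' q'' ->
  (forall y, dotv y y = 1 -> 0 < dotv y e -> q (dotv y e) + mu * dotv y e <= G y) ->
  G z = q (dotv z e) + mu * dotv z e ->
  (1 - dotv z e ^+ 2) * q''
    - (n%:R - 1) * (dotv z e * q' (dotv z e) - q (dotv z e))
  <= \sum_(i < n) H i i z - hessv H z z - (n%:R - 1) * gradv g z z
     + (n%:R - 1) * G z.
Proof.
move=> z1 t0 dq dq' Gmin Gz; set t := dotv z e in t0 dq' Gz *.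
have rot i j : j != i -> 0 <= hessv H z (rot_tangent z i j)
    - gradv g z (rot_radial z i j)
    - (q'' * dotv (rot_tangent z i j) e ^+ 2 - (q' t + mu) * dotv (rot_radial z i j) e).
  rewrite eq_sym => ij.
  have Ac s : A (rot_curve z i j s) by apply: SA; rewrite rot_curve_norm.
  have [du d1 d2] := rot_curve_variation Gj Ac.
  set P := rot_radial z i j in d2 *; set B := rot_tangent z i j in d2 *.
  pose ts (s : R) := t + (cos s - 1) * dotv P e + sin s * dotv B e.
  have tsE s : dotv (rot_curve z i j s) e = ts s.
    by rewrite /rot_curve dotvDl dotvDl !dotvZl.
  pose ts' (s : R) := - sin s * dotv P e + cos s * dotv B e.
  have dts (s : R) : is_derive s 1 ts (ts' s).
    rewrite /ts; apply: is_derive_eq; rewrite /GRing.scale /= /ts'; ring.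
  have dts' : is_derive (0 : R) 1 ts' (- dotv P e).
    by rewrite /ts'; apply: is_derive_eq; rewrite /GRing.scale /= cos0 sin0; ring.
  have ts0 : ts 0 = t by rewrite /ts cos0 sin0; ring.
  have ts'0 : ts' 0 = dotv B e by rewrite /ts' cos0 sin0; ring.
  have near_t : \forall s \near (0 : R), 0 < ts s.
    have cts : {for (0 : R), continuous ts}.
      by apply/differentiable_continuous/derivable1_diffP; case: (dts 0).
    by apply: (cvgr_gt _ cts); rewrite ts0.
  pose f s := q (ts s) + mu * ts s - G (rot_curve z i j s).
  pose f1 s := (q' (ts s) + mu) * ts' s - du s.
  have df : \forall s \near (0 : R), is_derive (s : R) 1 f (f1 s).
    near=> s; have s0 : 0 < ts s by near: s.
    have h := is_derive1_comp (dq _ s0) (dts s); have h' := d1 s; have h'' := dts s.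
    have -> : f = (q \o ts) + mu *: ts - (G \o rot_curve z i j) by [].
    apply: (is_derive_eq (is_deriveB (is_deriveD h (is_deriveZ mu h'')) h')).
    by rewrite /GRing.scale /= /f1; ring.
  have df1 : is_derive (0 : R) 1 f1 (q'' * dotv B e ^+ 2 - (q' t + mu) * dotv P e
      - (hessv H z B - gradv g z P)).
    have h1 : is_derive (ts 0) 1 q' q'' by rewrite ts0.
    have h2 := dts 0; have h := is_derive1_comp h1 h2.
    have -> : f1 = ((q' \o ts) + cst mu) * ts' - du by [].
    apply: is_derive_eq.
    have -> : ((q' \o ts) + cst mu) 0 = q' (ts 0) + mu by [].
    by rewrite /GRing.scale /= ts'0 ts0; ring.
  have fmax : \forall s \near (0 : R), f s <= f 0.
    near=> s; have s0 : 0 < ts s by near: s.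
    have -> : f 0 = 0.
      rewrite /f -tsE /rot_curve cos0 sin0 subrr !scale0r !addr0 -/t -Gz subrr.
      by [].
    rewrite /f subr_le0 -tsE; apply: Gmin; first by rewrite rot_curve_norm.
    by rewrite tsE.
  have [_] := near_max_test df df1 fmax; lra.
have : 0 <= \sum_(i < n) \sum_(j < n | j != i) (hessv H z (rot_tangent z i j)
    - gradv g z (rot_radial z i j)
    - (q'' * dotv (rot_tangent z i j) e ^+ 2 - (q' t + mu) * dotv (rot_radial z i j) e)).
  by apply: sumr_ge0 => i _; apply: sumr_ge0 => j; exact: rot.
under eq_bigr do rewrite !sumrB -!mulr_sumr.
rewrite !sumrB -!mulr_sumr sum_rot_tangent // sum_rot_radial sum_rot_linear.
rewrite sum_rot_sqr // -/t.
rewrite Gz; lra.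
Unshelve. all: by end_near. Qed.

End SphereMinimum.

(** * The gradient bound for harmonic functions at the centre *)

Section HarmonicCore.
Context {R : realType} {n : nat}.
Implicit Types (x y z a : 'rV[R]_n).
Variables (v : 'rV[R]_n -> R) (g : 'I_n -> 'rV[R]_n -> R).
Variables (H : 'I_n -> 'I_n -> 'rV[R]_n -> R) (k : nat) (r : R) (e : 'rV[R]_n).
Hypotheses (nk : n = k.+1) (k2 : (2 <= k)%N) (r1 : 1 < r) (e1 : dotv e e = 1).
Let U : set 'rV[R]_n := [set x | enorm x < r].
Hypothesis vj : jet2_on U v g H.
Hypothesis harm : forall x, U x -> \sum_(i < n) H i i x = 0.
Hypothesis v1 : forall x, dotv x x <= 1 -> v x <= 1.
Hypothesis odd : forall x, U x -> v (x *m reflm e) = - v x.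

Let beta := gradv g 0 e.

Let U_le1 x : dotv x x <= 1 -> U x.
Proof.
move=> x1; apply: le_lt_trans r1.
by rewrite enormE -[leRHS]sqrtr1 ler_wsqrtr.
Qed.

Let U_ray (t : R) z : dotv z z = 1 -> 0 <= t <= 1 -> U (t *: z).
Proof.
move=> z1 /andP[t0 t1]; apply: U_le1; rewrite dotvZl dotvZr z1 mulr1.
by rewrite -expr2 exprn_ile1.
Qed.

Let odd_fixed x : U x -> dotv x e = 0 -> v x = 0.
Proof.
move=> Ux xe; have := odd Ux; rewrite mulmx_reflm xe mulr0 mul0r scale0r subr0.
lra.
Qed.

Let U_near a : \forall s \near (0 : R), U (s *: a).
Proof.
have ce : {for (0 : R), continuous (fun s : R => enorm (s *: a))}.
  apply: (@continuous_comp _ _ _ (fun s : R => s *: a)); last exact: enorm_continuous.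
  exact: scalel_continuous.
have : enorm ((0 : R) *: a) < r.
  by rewrite enormZ normr0 mul0r (lt_trans _ r1).
by move=> h; apply: (cvgr_lt _ ce).
Qed.

Lemma odd_grad0 z : gradv g 0 z = beta * dotv z e.
Proof.
have g0 a : dotv a e = 0 -> gradv g 0 a = 0.
  move=> ae.
  have U0 : U ((0 : R) *: a) by exact: (nbhs_singleton (U_near a)).
  have [d _] := jet_ray vj U0; rewrite scale0r in d.
  have := is_derive_cvg0 d => lim1.
  have lim0 : s^-1 * (v (s *: a) - v ((0 : R) *: a)) @[s --> (0 : R)^'] --> (0 : R).
    apply: cvg_near_cst; apply: nbhs_dnbhs; near=> s.
    rewrite !odd_fixed ?subr0 ?mulr0 ?dotvZl ?ae ?mulr0 //.
    by near: s; exact: U_near.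
  exact: (cvg_unique _ lim1 lim0).
have -> : z = (z - dotv z e *: e) + dotv z e *: e by rewrite subrK.
rewrite gradvD g0; last by rewrite dotvBl dotvZl e1; ring.
rewrite add0r gradvZ dotvDl dotvBl !dotvZl e1 mulrC; congr (_ * _); ring.
Unshelve. all: by end_near. Qed.

(** [v] vanishes on the hyperplane orthogonal to [e]; integrate from there in
    direction [e]. *)
Lemma odd_lipschitz : exists2 L : R, 0 <= L &
  forall y, dotv y y <= 1 -> `|v y| <= L * `|dotv y e|.
Proof.
have cK := @enorm_le_compact R n 1.
have K0 : [set x : 'rV[R]_n | enorm x <= 1] !=set0.
  by exists 0; rewrite /= enormE dotv0l sqrtr0.
have KU x : enorm x <= 1 -> U x by move=> h; apply: le_lt_trans r1.
have [|m mK hm] := compact_EVT_max (f := fun x => `|gradv g x e|) K0 cK.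
  apply: continuous_in_subspaceT => x /set_mem /= /KU Ux.
  apply: (@continuous_comp _ _ _ (fun x => gradv g x e) (fun t => `|t|)).
    apply: (@gradv_continuous R n g _ (fun x => x) (fun=> e)).
    - by move=> i; exact: has_grad_continuous (jet_hess vj i Ux).
    - exact: cvg_id.
    - exact: cst_continuous.
  exact: norm_continuous.
exists `|gradv g m e| => // y y1.
have ptE' q (s : R) : dotv q e = 0 ->
    dotv (q + s *: e) (q + s *: e) = dotv q q + s ^+ 2.
  by move=> qe; rewrite !dotvE e1 (dotvC e q) qe; ring.
pose t := dotv y e; pose p := y - t *: e.
have pe : dotv p e = 0 by rewrite dotvBl dotvZl e1 mulr1 subrr.
have ptE (s : R) : dotv (p + s *: e) (p + s *: e) = dotv p p + s ^+ 2.
  exact: ptE'.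
have yE : y = p + t *: e by rewrite subrK.
have pt1 (s : R) : s ^+ 2 <= t ^+ 2 -> dotv (p + s *: e) (p + s *: e) <= 1.
  by move=> st; rewrite ptE; move: y1; rewrite {1 2}yE ptE; lra.
have vp : v p = 0.
  apply: odd_fixed => //; apply: U_le1.
  have := pt1 0; rewrite scale0r addr0 => -> //.
  by rewrite expr0n sqr_ge0.
have bd (s : R) : s ^+ 2 <= t ^+ 2 -> `|gradv g (p + s *: e) e| <= `|gradv g m e|.
  move=> st; apply: (hm (p + s *: e)); apply/mem_set => /=.
  by rewrite enormE -[leRHS]sqrtr1 ler_wsqrtr // pt1.
have der (s : R) : s ^+ 2 <= t ^+ 2 ->
    is_derive s 1 (fun s => v (p + s *: e)) (gradv g (p + s *: e) e).
  by move=> st; case: (jet_line vj (U_le1 (pt1 s st))).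
have -> : v y = v (p + t *: e) by rewrite -yE.
rewrite -/t.
have mvt (a b : R) : a <= b -> (forall s, a <= s <= b -> s ^+ 2 <= t ^+ 2) ->
    `|v (p + b *: e) - v (p + a *: e)| <= `|gradv g m e| * (b - a).
  move=> ab hs.
  have [c cin ->] : exists2 c, c \in `[a, b]%R &
     v (p + b *: e) - v (p + a *: e) = gradv g (p + c *: e) e * (b - a).
    apply: (@MVT_segment R (fun s => v (p + s *: e))) => // [s|].
      by rewrite in_itv /= => /andP[s1 s2]; apply/der/hs; rewrite !ltW.
    apply: derivable_within_continuous => s; rewrite in_itv /= => ss.
    by case: (der s (hs s ss)).
  rewrite normrM [`|b - a|]ger0_norm ?subr_ge0 // ler_wpM2r ?subr_ge0 //.
  by apply/bd/hs; move: cin; rewrite in_itv.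
have [t0|t0] := leP 0 t.
  have := mvt 0 t t0; rewrite scale0r addr0 vp !subr0 [`|t|]ger0_norm //; apply.
  by move=> s /andP[s0 st]; rewrite ler_pXn2r ?nnegrE.
have := mvt t 0 (ltW t0); rewrite scale0r addr0 vp !sub0r normrN [`|t|]ltr0_norm //; apply.
move=> s /andP[s0 st]; rewrite -sqrrN -[leRHS]sqrrN ler_pXn2r ?nnegrE //; lra.
Qed.

Lemma ray_grad_near0 (eta : R) : 0 < eta -> exists2 w : R, 0 < w &
  forall z t, dotv z z = 1 -> 0 <= t <= 1 -> t < w ->
    `|gradv g (t *: z) z - beta * dotv z e| <= eta.
Proof.
move=> eta0.
pose f (q : R * 'rV[R]_n) := gradv g (q.1 *: q.2) q.2.
have cK : compact (`[0, 1]%classic `*` [set z : 'rV[R]_n | dotv z z = 1] : set (R * 'rV[R]_n)%type).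
  by apply: compact_setX; [exact: segment_compact | exact: sphere_compact].
have [|w w0 hw] := compact_unif_continuous (f := f) cK _ eta0.
  move=> [t z] [/= t01 z1]; rewrite in_itv /= in t01.
  apply: (@gradv_continuous R n g (R * 'rV[R]_n)%type (fun q => q.1 *: q.2) snd).
  - by move=> i; exact: has_grad_continuous (jet_hess vj i (U_ray z1 t01)).
  - exact: scale_continuous.
  - exact: cvg_snd.
exists w => // z t z1 t01 tw; rewrite distrC.
have := hw (0, z) (t, z); rewrite /f /= scale0r odd_grad0.
move=> h; apply/ltW/h.
  by split=> //=; rewrite in_itv /= lexx ler01.
split=> /=; last exact: ballxx.
by rewrite /ball /= sub0r normrN ger0_norm //; case/andP: t01.
Qed.

(** At [x = t *: z] with [z] on the unit sphere, this is the value at [z] of the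
    sphere Laplacian plus [k = n - 1], applied to [z |-> v (t *: z)]: for a
    harmonic function the sphere Laplacian is minus the radial part of the
    Laplacian. *)
Definition bulk x : R := k%:R * v x - k%:R * gradv g x x - hessv H x x.

(** [t ^ (n - 2) - t ^ (- 2)]: a combination of the two powers for which the
    weighted radial operator is a derivative, and which vanishes at [1]. *)
Definition weight (t : R) : R := (t ^+ k.+1 - 1) / t ^+ 2.

(** A primitive of [weight * bulk] along the ray of [z]. At the outer end it only
    sees the value of [v], and in the limit at the inner end only the gradient at
    the centre. *)
Definition flux z (t : R) : R :=
  (1 - t ^+ k.+1) * gradv g (t *: z) z + (t ^+ k + k%:R / t) * v (t *: z).

Lemma flux_derive z t : 0 < t -> U (t *: z) ->
  is_derive t 1 (flux z) (weight t * bulk (t *: z)).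
Proof.
move=> t0 Ut; have [d1 d2] := jet_ray vj Ut.
have tn : t != 0 by rewrite gt_eqF.
have dX j : is_derive t 1 (fun t : R => t ^+ j.+1) (j.+1%:R * t ^+ j).
  have := @is_deriveX R R id j.+1 t 1 1 _; rewrite exprfctE /= [_ *: 1]mulr1; exact.
have dV : is_derive t 1 (fun t : R => t^-1) (- t ^- 2).
  have := is_deriveV tn (@is_derive_id R R t 1); rewrite [_ *: 1]mulr1; exact.
rewrite /flux /bulk /weight gradvZ hessvZ; case: k k2 => [//|j] _.
have dk := dX j; have dk1 := dX j.+1.
apply: is_derive_eq.
rewrite /GRing.scale /= !exprS.
have -> : j.+2%:R = j.+1%:R + 1 :> R by rewrite -[in LHS]natr1.
field.
by [].
Qed.

Lemma flux1 z : flux z 1 = n%:R * v z.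
Proof. by rewrite /flux !expr1n subrr mul0r add0r scale1r divr1 nk -natr1 addrC. Qed.

(** Both terms of [flux] are governed by the radial derivative near the centre,
    with weights [1 - d ^ n] and [d ^ n + n - 1], whose sum is [n]. *)
Lemma flux_near0 (eta : R) : 0 < eta -> exists2 d : R, 0 < d < 1 &
  forall z, dotv z z = 1 -> `|flux z d - n%:R * (beta * dotv z e)| <= n%:R * eta.
Proof.
move=> eta0; have [w w0 hw] := ray_grad_near0 eta0.
have [d [d0 d1 dw]] : exists d : R, [/\ 0 < d, d < 1 & d < w].
  exists (Num.min 1 w / 2); have m0 : 0 < Num.min 1 w by rewrite lt_min ltr01 w0.
  have [m1 m2] : Num.min 1 w <= 1 /\ Num.min 1 w <= w by rewrite !ge_min !lexx orbT.
  by split; lra.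
exists d; first by rewrite d0.
move=> z z1; have d01 : 0 <= d <= 1 by rewrite !ltW.
have [c cin vE] : exists2 c, c \in `]0, d[%R &
    v (d *: z) - v ((0 : R) *: z) = gradv g (c *: z) z * (d - 0).
  have dv (t : R) : 0 <= t <= d -> is_derive t 1 (fun t => v (t *: z)) (gradv g (t *: z) z).
    move=> /andP[t0 td]; apply: (jet_ray vj (U_ray z1 _)).1.
    by rewrite t0 (le_trans td) // ltW.
  apply: (@MVT R (fun t => v (t *: z))) => // [t|].
    by rewrite in_itv /= => /andP[t1 t2]; apply: dv; rewrite !ltW.
  apply: derivable_within_continuous => t; rewrite in_itv /= => tt.
  by case: (dv t tt).
move: cin; rewrite in_itv /= => /andP[c0 cd].
have v0 : v ((0 : R) *: z) = 0.
  by rewrite scale0r odd_fixed ?dotv0l //; apply: U_le1; rewrite dotv0l.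
rewrite v0 !subr0 in vE.
have h1 := hw z d z1 d01 dw.
have h2 : `|gradv g (c *: z) z - beta * dotv z e| <= eta.
  apply: hw => //; last by rewrite (lt_trans cd).
  by rewrite !ltW // (lt_trans cd).
rewrite /flux vE; set A := gradv _ _ _ in h1 *; set B := gradv _ _ _ in h2 *.
set b := beta * _ in h1 h2 *.
have dk : 0 <= d ^+ k.+1 <= 1 by rewrite exprn_ge0 ?exprn_ile1 ?ltW.
have -> : (1 - d ^+ k.+1) * A + (d ^+ k + k%:R / d) * (B * d) - n%:R * b
  = (1 - d ^+ k.+1) * (A - b) + (d ^+ k.+1 + k%:R) * (B - b).
  rewrite exprS nk -natr1; field.
  by rewrite gt_eqF.
have nE : n%:R = (1 - d ^+ k.+1) + (d ^+ k.+1 + k%:R) :> R.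
  by rewrite nk -natr1; ring.
move: dk => /andP[dk0 dk1].
rewrite [in leRHS]nE [leRHS]mulrDl; apply: le_trans (ler_normD _ _) _.
apply: lerD; rewrite normrM ger0_norm ?subr_ge0 ?addr_ge0 //.
  by apply: ler_wpM2l => //; rewrite subr_ge0.
by apply: ler_wpM2l => //; rewrite addr_ge0.
Qed.

Lemma bulk_continuous x : U x -> {for x, continuous bulk}.
Proof.
move=> Ux; rewrite /bulk.
have cg i : {for x, continuous (g i)}.
  exact: has_grad_continuous (jet_hess vj i Ux).
have ci : {for x, continuous (fun x : 'rV[R]_n => x)} by exact: cvg_id.
have c1 : {for x, continuous (fun x => k%:R * v x)}.
  apply: (@continuous_comp _ _ _ v (fun t => k%:R * t)).
    exact: has_grad_continuous (jet_grad vj Ux).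
  by apply: cvgM; [exact: cvg_cst | exact: cvg_id].
have c2 : {for x, continuous (fun x => k%:R * gradv g x x)}.
  apply: (@continuous_comp _ _ _ (fun x => gradv g x x) (fun t => k%:R * t)).
    exact: (@gradv_continuous R n g _ (fun x => x) (fun x => x)).
  by apply: cvgM; [exact: cvg_cst | exact: cvg_id].
have c3 : {for x, continuous (fun x => hessv H x x)}.
  apply: (@hessv_continuous R n H _ (fun x => x) (fun x => x)) => //.
  by move=> i j; exact: jet_cont vj i j x Ux.
by apply: (continuousB (continuousB c1 c2) c3).
Qed.

Lemma flux_riemann (d eta : R) : 0 < d < 1 -> 0 < eta ->
  exists2 N, (0 < N)%N & forall z, dotv z z = 1 ->
    `|\sum_(m < N) (1 - d) / N%:R * (weight (d + m%:R * ((1 - d) / N%:R))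
         * bulk ((d + m%:R * ((1 - d) / N%:R)) *: z))
      - (flux z 1 - flux z d)| <= eta.
Proof.
move=> /andP[d0 d1] eta0.
pose f (q : R * 'rV[R]_n) := weight q.1 * bulk (q.1 *: q.2).
have cK : compact (`[d, 1]%classic `*` [set z : 'rV[R]_n | dotv z z = 1] : set (R * 'rV[R]_n)%type).
  by apply: compact_setX; [exact: segment_compact | exact: sphere_compact].
have [|w w0 hw] := compact_unif_continuous (f := f) cK _ eta0.
  move=> [t z] [/= t01 z1]; rewrite in_itv /= in t01; case/andP: t01 => td t1.
  have t0 : 0 < t by apply: lt_le_trans td.
  have Ut : U (t *: z) by apply: U_ray => //; rewrite t1 ltW.
  have cw : {for t, continuous weight}.
    apply: cvgM.
      apply: cvgB; last exact: cvg_cst.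
      exact: exprn_continuous.
    apply: cvgV; first by rewrite expf_eq0 /= gt_eqF.
    exact: exprn_continuous.
  have c1 : {for (t, z), continuous (fun q : R * 'rV[R]_n => weight q.1)}.
    apply: (@continuous_comp _ _ _ (fst : R * 'rV[R]_n -> R) weight (t, z)).
      exact: cvg_fst.
    exact: cw.
  have c2 : {for (t, z), continuous (fun q : R * 'rV[R]_n => bulk (q.1 *: q.2))}.
    apply: (continuous_comp (f := fun q : R * 'rV[R]_n => q.1 *: q.2)).
      exact: scale_continuous.
    exact: bulk_continuous.
  exact: (continuousM c1 c2).
have [N N0 hN] : exists2 N, (0 < N)%N & (1 - d) / N%:R < w.
  exists (Num.truncn ((1 - d) / w)).+1 => //.
  rewrite ltr_pdivrMr ?ltr0n // mulrC -ltr_pdivrMr //.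
  by apply: truncnS_gt.
exists N => // z z1.
have := @riemann_sum_error R (flux z) (fun t => weight t * bulk (t *: z)) d 1 eta N N0 d1.
have in01 t : d <= t <= 1 -> 0 < t /\ U (t *: z).
  move=> /andP[td t1]; have t0 : 0 < t by apply: lt_le_trans td.
  by split=> //; apply: U_ray => //; rewrite t1 ltW.
move=> h; apply: le_trans (h _ _) _.
- by move=> t /in01[t0 Ut]; exact: flux_derive.
- move=> s t sI tI st; apply: ltW; apply: (hw (s, z) (t, z)).
    by split => //=; rewrite in_itv.
  split => /=; last exact: ballxx.
  by rewrite /ball /=; apply: le_lt_trans hN.
- by rewrite ler_piMl ?(ltW eta0) //; lra.
Qed.

(** The Riemann sum [G] stands for the weighted average of [v] along rays, divided
    by [n]. If [beta] exceeded [n / 2], the minimum over the open hemisphere of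
    [ratio], the quotient of [G - q] by the height, would contradict
    [sphere_min_variation]. *)
Lemma harmonic_center : gradv g 0 e <= n%:R / 2.
Proof.
rewrite leNgt -/beta; apply/negP => big.
have n0 : 0 < n%:R :> R by rewrite nk ltr0n.
have n3 : 3 <= n%:R :> R by rewrite ler_nat nk.
have nE : n%:R = k%:R + 1 :> R by rewrite nk -natr1.
(* The operator sends [eps * (t * ln t)] to [eps / t - eps * n * t]; this choice
   makes the second term spend exactly the excess of [beta]. *)
pose eps := (beta - n%:R / 2) / n%:R.
have eps0 : 0 < eps by rewrite divr_gt0 // subr_gt0.
have epsE : eps * n%:R = beta - n%:R / 2 by rewrite divfK ?gt_eqF.
pose eta := eps / 4.
have eta0 : 0 < eta by rewrite divr_gt0.
have [d /andP[d0 d1] fd] := flux_near0 eta0.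
have d01 : 0 < d < 1 by rewrite d0.
have [N N0 fN] := flux_riemann d01 (mulr_gt0 n0 eta0).
have N0' : 0 < N%:R :> R by rewrite ltr0n.
pose h := (1 - d) / N%:R; have h0 : 0 < h by rewrite divr_gt0 // subr_gt0.
pose tau (m : 'I_N) := d + m%:R * h.
have tau0 m : 0 <= tau m.
  by apply: addr_ge0; [exact: ltW | apply: mulr_ge0 => //; exact: ltW].
have tau1 m : tau m <= 1.
  have -> : 1 = d + N%:R * h by rewrite /h mulrC divfK ?gt_eqF // addrC subrK.
  rewrite lerD2l; apply: ler_wpM2r; first exact: ltW.
  by rewrite ler_nat ltnW.
pose c (m : 'I_N) := h * weight (tau m) / n%:R.
have Uscale m x : U x -> U (tau m *: x).
  move=> Ux; apply: le_lt_trans Ux; rewrite enormZ ger0_norm //.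
  by rewrite ler_piMl ?enorm_ge0.
have Gj := jet2_sum c (fun m => jet2_scale vj (Uscale m)).
set G := (fun x => \sum_(m < N) c m * v (tau m *: x)) in Gj.
set gG := (fun i x => \sum_(m < N) _) in Gj.
set HG := (fun i j x => \sum_(m < N) _) in Gj.
have US z : dotv z z = 1 -> U z by move=> z1; apply: U_le1; rewrite z1.
have bulkE z : dotv z z = 1 -> \sum_(i < n) HG i i z - hessv HG z z
    - (n%:R - 1) * gradv gG z z + (n%:R - 1) * G z
    = \sum_(m < N) c m * bulk (tau m *: z).
  move=> z1.
  have -> : \sum_(i < n) HG i i z = 0.
    rewrite exchange_big big1 //= => m _; rewrite -mulr_sumr -mulr_sumr.
    by rewrite harm ?mulr0 //; apply/Uscale/US.
  have -> : hessv HG z z = \sum_(m < N) c m * hessv H (tau m *: z) (tau m *: z).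
    rewrite /hessv /HG.
    under eq_bigr => j _.
      under eq_bigr => i _ do rewrite mulr_sumr.
      rewrite exchange_big mulr_sumr /=.
    over.
    rewrite exchange_big; apply: eq_bigr => m _ /=; rewrite mulr_sumr.
    apply: eq_bigr => j _; rewrite !mxE !mulr_sumr; apply: eq_bigr => i _.
    by rewrite mxE; ring.
  have -> : gradv gG z z = \sum_(m < N) c m * gradv g (tau m *: z) (tau m *: z).
    rewrite /gradv /gG; under eq_bigr => i _ do rewrite mulr_sumr.
    rewrite exchange_big; apply: eq_bigr => m _ /=; rewrite mulr_sumr.
    by apply: eq_bigr => i _; rewrite mxE; ring.
  rewrite sub0r -sumrN !mulr_sumr -sumrB -big_split /=; apply: eq_bigr => m _.
  rewrite /bulk nE; ring.
have upper z : dotv z z = 1 -> \sum_(m < N) c m * bulk (tau m *: z)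
    <= v z - beta * dotv z e + 2 * eta.
  move=> z1; have := fN z z1; have := fd z z1.
  rewrite !ler_norml flux1 => /andP[a1 a2] /andP[a3 a4].
  have -> : \sum_(m < N) c m * bulk (tau m *: z) =
     (\sum_(m < N) h * (weight (tau m) * bulk (tau m *: z))) / n%:R.
    by rewrite mulr_suml; apply: eq_bigr => m _; rewrite /c; ring.
  rewrite ler_pdivrMr //; rewrite -/h in a3 a4.
  set s := \sum_(m < N) _; rewrite -/s in a3 a4.
  lra.
have [L L0 hL] := odd_lipschitz.
pose C := \sum_(m < N) `|c m| * L.
have C0 : 0 <= C by apply: sumr_ge0 => m _; rewrite mulr_ge0.
have Glow z : dotv z z = 1 -> 0 < dotv z e -> - C * dotv z e <= G z.
  move=> z1 t0; rewrite mulNr; apply: lerNnormlW.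
  rewrite /C mulr_suml (le_trans (ler_norm_sum _ _ _)) //.
  apply: ler_sum => m _; rewrite normrM -mulrA ler_wpM2l //.
  apply: le_trans (hL _ _) _.
    rewrite dotvZl dotvZr z1 mulr1 -expr2; exact: exprn_ile1.
  by rewrite ler_wpM2l // dotvZl ger0_norm ?mulr_ge0 ?(ltW t0) // ler_piMl // ltW.
pose ratio z := G z / dotv z e - ln (1 + dotv z e) / 2 - eps * ln (dotv z e).
(* Below the height [t0] the logarithm in [ratio] outweighs its value at the pole
   [e], as [G] is at least [- C] times the height. *)
pose t0 := expR (- ((C + 1 + `|ratio e|) / eps)).
have t00 : 0 < t0 by exact: expR_gt0.
have t01 : t0 <= 1.
  rewrite expR_le1 oppr_le0 divr_ge0 ?(ltW eps0) //.
  by rewrite !addr_ge0.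
have ratio_low z : dotv z z = 1 -> 0 < dotv z e -> dotv z e < t0 ->
    ratio e < ratio z.
  move=> z1 tp tt.
  have l1 : ln (dotv z e) < - ((C + 1 + `|ratio e|) / eps).
    by rewrite -[ltRHS]expRK ltr_ln ?posrE.
  have l2 : C + 1 + `|ratio e| < - (eps * ln (dotv z e)).
    by rewrite -mulrN -ltr_pdivrMl // mulrC ltrNr.
  have l3 : ln (1 + dotv z e) <= dotv z e by apply: le_ln1Dx; lra.
  have l4 : - C <= G z / dotv z e by rewrite ler_pdivlMr // Glow.
  have l5 := ler_norm (ratio e).
  rewrite [X in _ < X]/ratio; lra.
pose K := [set z : 'rV[R]_n | dotv z z = 1] `&` [set z | t0 <= dotv z e].
have cK : compact K.
  apply: compact_closedI; first exact: sphere_compact.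
  apply: (closed_comp (f := fun z : 'rV[R]_n => dotv z e) (D := [set t | t0 <= t])).
    move=> x _; apply: dotv_continuous; first exact: cvg_id.
    exact: cst_continuous.
  exact: closed_ge.
have Ke : K e by split=> //=; rewrite e1.
have [|z /set_mem [/= z1 zt] zmin] := compact_EVT_min (f := ratio) (ex_intro _ e Ke) cK.
  apply: continuous_in_subspaceT => x /set_mem [/= x1 xt].
  have xp : 0 < dotv x e by apply: lt_le_trans xt.
  have ct : {for x, continuous (fun z : 'rV[R]_n => dotv z e)}.
    apply: dotv_continuous; first exact: cvg_id.
    exact: cst_continuous.
  have cG : {for x, continuous G} := has_grad_continuous (jet_grad Gj (US x x1)).
  have c1 : {for x, continuous (fun z : 'rV[R]_n => G z / dotv z e)}.
    apply: (continuousM cG).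
    apply: (@continuous_comp _ _ _ (fun z : 'rV[R]_n => dotv z e) (@GRing.inv R) x ct).
    by apply: inv_continuous; rewrite gt_eqF.
  have c2 : {for x, continuous (fun z : 'rV[R]_n => ln (1 + dotv z e) / 2)}.
    apply: (@continuous_comp _ _ _ (fun z : 'rV[R]_n => dotv z e) (fun t : R => ln (1 + t) / 2) x ct).
    apply: cvgM; last exact: cvg_cst.
    apply: (@continuous_comp _ _ _ (fun t : R => 1 + t) (@ln R)).
      by apply: cvgD; [exact: cvg_cst | exact: cvg_id].
    by apply: continuous_ln; rewrite addr_gt0.
  have c3 : {for x, continuous (fun z : 'rV[R]_n => eps * ln (dotv z e))}.
    apply: (@continuous_comp _ _ _ (fun z : 'rV[R]_n => dotv z e) (fun t : R => eps * ln t) x ct).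
    apply: cvgM; first exact: cvg_cst.
    exact: continuous_ln.
  exact: (continuousB (continuousB c1 c2) c3).
have tp : 0 < dotv z e by apply: lt_le_trans zt.
have gmin y : dotv y y = 1 -> 0 < dotv y e -> ratio z <= ratio y.
  move=> y1 yp; have [yt|yt] := leP t0 (dotv y e).
    by apply: zmin; apply/mem_set.
  apply: le_trans (ltW (ratio_low y y1 yp yt)).
  by apply: zmin; apply/mem_set.
pose q (t : R) := t * ln (1 + t) / 2 + eps * (t * ln t).
pose q' (t : R) := (ln (1 + t) + t / (1 + t)) / 2 + eps * (ln t + 1).
have GE y : 0 < dotv y e -> G y = q (dotv y e) + ratio y * dotv y e.
  move=> yp; rewrite /q /ratio; field.
  by rewrite gt_eqF.
have dln1 (t : R) : 0 < t -> is_derive t 1 (fun t : R => ln (1 + t)) ((1 + t)^-1).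
  move=> tt; have t1 : 0 < 1 + t by rewrite addr_gt0.
  have hh : is_derive t 1 (fun s : R => 1 + s) 1 by apply: is_derive_eq; ring.
  have := is_derive1_comp (is_derive1_ln t1) hh; rewrite mulr1; exact.
have dq (t : R) : 0 < t -> is_derive t 1 q (q' t).
  move=> tt; have h1 := dln1 t tt; have h2 := is_derive1_ln tt.
  rewrite /q; apply: is_derive_eq; rewrite /GRing.scale /= /q'; field.
  by rewrite !gt_eqF ?addr_gt0.
have dq' (t : R) : 0 < t -> is_derive t 1 q' ((2 + t) / (1 + t) ^+ 2 / 2 + eps / t).
  move=> tt; have h1 := dln1 t tt; have h2 := is_derive1_ln tt.
  have t1 : 1 + t != 0 by rewrite gt_eqF ?addr_gt0.
  have hh : is_derive t 1 (fun s : R => 1 + s) 1 by apply: is_derive_eq; ring.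
  have h3 := is_deriveV t1 hh.
  rewrite /q'; apply: is_derive_eq; rewrite /GRing.scale /=; field.
  by rewrite t1 gt_eqF.
have Gm y : dotv y y = 1 -> 0 < dotv y e ->
    q (dotv y e) + ratio z * dotv y e <= G y.
  by move=> y1 yp; rewrite (GE y yp) lerD2l ler_wpM2r ?(ltW yp) ?gmin.
have := sphere_min_variation Gj US e1 z1 tp dq (dq' _ tp) Gm (GE z tp).
rewrite bulkE // => key; have {key} := le_trans key (upper z z1).
have vz : v z <= 1 by apply: v1; rewrite z1.
set t := dotv z e in tp *.
have t_1 : t <= 1.
  by apply: le_trans (cauchy_schwarz z e) _; rewrite !enormE z1 e1 sqrtr1 mulr1.
have t1 : 0 < 1 + t by rewrite addr_gt0.
have -> : (1 - t ^+ 2) * ((2 + t) / (1 + t) ^+ 2 / 2 + eps / t)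
     - (n%:R - 1) * (t * q' t - q t)
   = (1 + (n%:R - 1) / 2 * t) / (1 + t) - n%:R / 2 * t + eps / t - eps * n%:R * t.
  by rewrite /q' /q; field; rewrite !gt_eqF.
have p1 : 1 <= (1 + (n%:R - 1) / 2 * t) / (1 + t).
  rewrite ler_pdivlMr // mul1r lerD2l ler_peMl ?(ltW tp) //; lra.
have et : eps <= eps / t by rewrite ler_pdivlMr // ler_piMr // ltW.
rewrite epsE /eta; apply/negP; rewrite -ltNge.
set p := _ / (1 + t) in p1 *.
have -> : (beta - n%:R / 2) * t = beta * t - n%:R / 2 * t by ring.
lra.
Qed.

End HarmonicCore.

(** * From the centre to an arbitrary point *)

Section Recentering.
Context {R : realType} {n : nat}.
Implicit Types (x y e : 'rV[R]_n).

Lemma dotv_mulmx x (M : 'M[R]_n) (c : R) :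
  M *m M^T = c%:M -> dotv (x *m M) (x *m M) = c * dotv x x.
Proof.
move=> MM; have := mulmx_tr_dotv (x *m M) (x *m M).
rewrite trmx_mul mulmxA -(mulmxA x) MM mul_mx_scalar -scalemxAl mulmx_tr_dotv.
by move=> /matrixP /(_ 0 0); rewrite !mxE eqxx !mulr1n.
Qed.

Lemma trace_affine (H : 'I_n -> 'I_n -> 'rV[R]_n -> R) x (M : 'M[R]_n) (c : R) :
  M^T *m M = c%:M ->
  \sum_(i < n) \sum_(l < n) M i l * \sum_(p < n) M i p * H l p x
  = c * \sum_(i < n) H i i x.
Proof.
move=> MM; rewrite -(sum_hessv_rows H x MM); apply: eq_bigr => i _.
rewrite /hessv; under eq_bigr do rewrite mulr_sumr.
rewrite exchange_big; apply: eq_bigr => p _ /=; rewrite mulr_sumr.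
by apply: eq_bigr => l _; rewrite !mxE; ring.
Qed.

Lemma gradv_affine (g : 'I_n -> 'rV[R]_n -> R) x (M : 'M[R]_n) e :
  \sum_(k < n) e 0 k * \sum_(l < n) M k l * g l x = gradv g x (e *m M).
Proof.
rewrite /gradv; under eq_bigr do rewrite mulr_sumr.
rewrite exchange_big; apply: eq_bigr => l _ /=; rewrite mxE mulr_suml.
by apply: eq_bigr => k _; rewrite mulrA.
Qed.

(** [harmonic_center] applies to the antisymmetric part of [u], restricted to the
    ball of radius [s] about [x] and dilated; the radius of this ball tends to
    the distance of [x] to the unit sphere. *)
Theorem harmonic_gradient_bound u g H k x e : n = k.+1 -> (2 <= k)%N ->
  jet2_on (unit_ball R n) u g H ->
  (forall z, unit_ball R n z -> \sum_(i < n) H i i z = 0) ->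
  (forall z, unit_ball R n z -> `|u z| <= 1) ->
  unit_ball R n x -> dotv e e = 1 ->
  gradv g x e <= n%:R / 2 * (1 / (1 - enorm x)).
Proof.
move=> nk k2 uj harm u1 Bx e1.
have x1 : 0 < 1 - enorm x by rewrite subr_gt0.
have e0 : dotv e e != 0 by rewrite e1 oner_eq0.
have key s : 0 < s -> s < 1 - enorm x -> s * gradv g x e <= n%:R / 2.
  move=> s0 sx.
  pose r := (1 - enorm x) / s.
  have r1 : 1 < r by rewrite ltr_pdivlMr // mul1r.
  (* The two terms of the antisymmetric part are two affine changes of variable,
     with coefficients [c]. *)
  pose M (j : 'I_2) : 'M[R]_n := if j == 0 then s%:M else s *: reflm e.
  pose c (j : 'I_2) : R := if j == 0 then 1 / 2 else - 1 / 2.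
  have Mtr j : (M j)^T = M j.
    rewrite /M; case: ifP => _; first by rewrite tr_scalar_mx.
    by rewrite linearZ /= reflm_tr.
  have Msq j : M j *m M j = (s ^+ 2)%:M.
    rewrite /M; case: ifP => _; first by rewrite -scalar_mxM expr2.
    by rewrite -scalemxAl -scalemxAr reflm_sqr // scalerA scalemx1 expr2.
  pose U := [set y : 'rV[R]_n | enorm y < r].
  have norm_M j y : enorm (y *m M j) = s * enorm y.
    rewrite !enormE (dotv_mulmx _ (c := s ^+ 2)) ?Mtr //.
    by rewrite sqrtrM ?sqr_ge0 // sqrtr_sqr gtr0_norm.
  have UB j y : U y -> unit_ball R n (x + y *m M j).
    rewrite /U /= ltr_pdivlMr // mulrC => Uy.
    apply: le_lt_trans (enorm_triangle _ _) _; rewrite norm_M; lra.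
  have vj := jet2_sum c (fun j => jet2_affine uj (@UB j)).
  have := @harmonic_center R n _ _ _ k r e nk k2 r1 e1 vj.
  have -> : gradv (fun i y => \sum_(j < 2) c j *
       \sum_(l < n) M j i l * g l (x + y *m M j)) 0 e = s * gradv g x e.
    rewrite [LHS]/gradv; under eq_bigr do rewrite mulr_sumr.
    rewrite exchange_big /= !big_ord_recl big_ord0 addr0.
    have E j : \sum_(i < n) e 0 i * (c j * \sum_(l < n) M j i l * g l (x + 0 *m M j))
       = c j * gradv g x (e *m M j).
      rewrite -gradv_affine mulr_sumr mul0mx addr0; apply: eq_bigr => i _; ring.
    rewrite !E /c /M /= mul_mx_scalar -scalemxAr mulmx_reflm e1.
    have -> : e - (2 * 1 / 1) *: e = - 1 *: e.
      by rewrite -{1}[e]scale1r -scalerBl; congr (_ *: _); field.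
    by rewrite !gradvZ; field.
  apply.
  - move=> y Uy; rewrite exchange_big big1 //= => j _.
    rewrite -mulr_sumr (@trace_affine H _ (M j) (s ^+ 2)) ?Mtr // harm ?mulr0 //.
    exact: UB.
  - move=> y y1.
    have Uy : U y.
      by apply: le_lt_trans r1; rewrite enormE -[leRHS]sqrtr1 ler_wsqrtr.
    have := u1 _ (UB 0 y Uy); have := u1 _ (UB 1 y Uy).
    rewrite !big_ord_recl big_ord0 addr0 /c /= !ler_norml.
    have -> : lift ord0 ord0 = 1 :> 'I_2 by apply/val_inj.
    move=> /andP[a1 a2] /andP[a3 a4]; lra.
  - move=> y Uy; rewrite !big_ord_recl !big_ord0 !addr0 /c /M /=.
    rewrite !mul_mx_scalar -!scalemxAr -mulmxA reflm_sqr // mulmx1; ring.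
rewrite mul1r ler_pdivlMr // leNgt; apply/negP => big.
have g0 : 0 < gradv g x e.
  by rewrite -(pmulr_lgt0 _ x1) (le_lt_trans _ big) // divr_ge0.
pose s := (n%:R / 2 / gradv g x e + (1 - enorm x)) / 2.
have q1 : n%:R / 2 / gradv g x e < 1 - enorm x by rewrite ltr_pdivrMr // [ltRHS]mulrC.
have q0 : 0 <= n%:R / 2 / gradv g x e by rewrite divr_ge0 ?divr_ge0 // ltW.
have s0 : 0 < s by rewrite /s; lra.
have sx : s < 1 - enorm x by rewrite /s; lra.
have := key s s0 sx; rewrite -ler_pdivlMr // /s; lra.
Qed.

End Recentering.

(** * Vector-valued functions *)

Section VectorValued.
Context {R : realType} {n m : nat}.
Implicit Types (h : 'rV[R]_n -> 'rV[R]_m) (x v : 'rV[R]_n).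

Lemma diff_coord h x v :
  (forall j, differentiable (fun y => h y 0 j) x) ->
  forall j, 'd h x v 0 j = \sum_(i < n) v 0 i * partial i (fun y => h y 0 j) x.
Proof.
move=> dh j.
have dfh : differentiable h x.
  have -> : h = \sum_(j < m) (fun y => h y 0 j *: delta_mx 0 j).
    apply/funext => y; rewrite fct_sumE; exact: row_sum_delta.
  apply: differentiable_sum => l; exact: differentiableZl.
rewrite -deriveE // derive_mx; last exact: diff_derivable.
rewrite mxE deriveE //; exact: (has_grad_partial (dh j)).2.
Qed.

(** The norm of a nonzero vector [L] is its inner product with the unit vector
    [w] of its direction, so only the scalar functions [<w, h>] matter. *)
Lemma opnorm_le h x (b : R) : (0 < n)%N -> 0 <= b ->
  (forall j, differentiable (fun y => h y 0 j) x) ->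
  (forall (w : 'rV[R]_m) v, dotv w w = 1 -> dotv v v = 1 ->
     gradv (fun i y => \sum_(j < m) w 0 j * partial i (fun z => h z 0 j) y) x v <= b) ->
  opnorm ('d h x) <= b.
Proof.
move=> n0 b0 dh hb; apply: ge_sup.
  exists (enorm ('d h x (delta_mx 0 (Ordinal n0)))); exists (delta_mx 0 (Ordinal n0)) => //=.
  by rewrite enormE dotv_delta mxE !eqxx sqrtr1.
move=> _ [v /= v1 <-].
set L := 'd h x v; have [->|L0] := eqVneq L 0.
  by rewrite enormE dotv0l sqrtr0.
have Lp : 0 < enorm L by rewrite enormE sqrtr_gt0 lt_neqAle eq_sym dotv_eq0 L0 dotv_ge0.
pose w := (enorm L)^-1 *: L.
have w1 : dotv w w = 1.
  by rewrite dotvZl dotvZr -enorm_sqr; field; rewrite gt_eqF.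
have -> : enorm L = dotv w L.
  by rewrite dotvZl -enorm_sqr; field; rewrite gt_eqF.
apply: le_trans (hb w v w1 (enorm_eq1 v1)).
rewrite le_eqVlt; apply/orP; left; apply/eqP.
rewrite /dotv /gradv; under eq_bigr do rewrite (diff_coord v dh) mulr_sumr.
rewrite exchange_big; apply: eq_bigr => i _ /=; rewrite mulr_sumr.
by apply: eq_bigr => j _; ring.
Qed.

Lemma unit_combination_le1 h (w : 'rV[R]_m) x : unit_ball R m (h x) ->
  dotv w w = 1 -> `|\sum_(j < m) w 0 j * h x 0 j| <= 1.
Proof.
move=> hx w1; rewrite -/(dotv w (h x)) ler_norml lerNl -dotvNl.
have w1' : enorm w = 1 by rewrite enormE w1 sqrtr1.
have nw1 : enorm (- w) = 1 by rewrite enormE dotvNl dotvC dotvNl opprK w1 sqrtr1.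
apply/andP; split; apply: le_trans (cauchy_schwarz _ _) _.
  by rewrite nw1 mul1r ltW.
by rewrite w1' mul1r ltW.
Qed.

End VectorValued.

Lemma hyp_harmonic_jet (R : realType) n (u : 'rV[R]_n -> R) : hyp_harmonic u ->
  forall z, unit_ball R n z ->
    rho z * \sum_i partial i (partial i u) z
      + 2 * (n%:R - 2) * gradv (fun i => partial i u) z z = 0.
Proof.
move=> [_ hu] z Bz; have r0 := (unit_ball_rho z).1 Bz.
have := hu z Bz; rewrite /hyp_laplacian enorm_sqr -/(rho z) -/(laplacian u z).
rewrite -/(gradv (fun i => partial i u) z z) => e0.
apply: (mulfI (lt0r_neq0 r0)); rewrite mulr0 -[RHS]e0; rewrite /laplacian; ring.
Qed.

Unset Implicit Arguments.

Theorem theorem2p7 (R : realType) (n m : nat) (hn : (3 <= n)%N) (hm : (1 <= m)%N)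
    (h : 'rV[R]_n -> 'rV[R]_m)
    (hB : forall x, unit_ball R n x -> unit_ball R m (h x)) :
  (vharmonic h ->
     forall x, unit_ball R n x ->
       opnorm ('d h x) <= n%:R / 2 * (1 / (1 - enorm x))) /\
  (vhyp_harmonic h ->
     forall x, unit_ball R n x ->
       opnorm ('d h x) <= (n%:R - 1) * (1 / (1 - enorm x ^+ 2))).
Proof.
have [k nk] : exists k, n = k.+1.
  by exists n.-1; rewrite prednK // (leq_trans _ hn).
have k2 : (2 <= k)%N by rewrite -ltnS -[k.+1]nk.
have n0 : (0 < n)%N by rewrite nk.
split=> hh x Bx.
  apply: opnorm_le => // [|j|w v w1 v1].
  - have x1 : 0 < 1 - enorm x by rewrite subr_gt0.
    by rewrite mulr_ge0 ?divr_ge0 // ltW.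
  - exact: (hh j).1.1.1.
  have uj := jet2_sum (fun j => w 0 j) (fun j => C2_jet2 (hh j).1).
  apply: (harmonic_gradient_bound nk k2 uj) => // z Bz.
  - rewrite exchange_big big1 //= => j _.
    by rewrite -mulr_sumr [X in _ * X](hh j).2 ?mulr0.
  - exact: unit_combination_le1 (hB z Bz) w1.
apply: opnorm_le => // [|j|w v w1 v1].
- have x1 : 0 < 1 - enorm x ^+ 2 by rewrite enorm_sqr; exact/unit_ball_rho.
  by rewrite mulr_ge0 ?divr_ge0 ?(ltW x1) // subr_ge0 ler1n.
- exact: (hh j).1.1.1.
have uj := jet2_sum (fun j => w 0 j) (fun j => C2_jet2 (hh j).1).
have -> : (n%:R - 1) * (1 / (1 - enorm x ^+ 2)) = k%:R / rho x.
  have -> : n%:R - 1 = k%:R :> R by rewrite nk -natr1 addrK.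
  by rewrite enorm_sqr mul1r.
apply: (hyperbolic_gradient_bound nk k2 uj) => // z Bz; last first.
  exact: unit_combination_le1 (hB z Bz) w1.
have e0 j := hyp_harmonic_jet (hh j) Bz.
have -> : \sum_i \sum_(j < m) w 0 j * partial i (partial i (fun y => h y 0 j)) z
    = \sum_(j < m) w 0 j * \sum_i partial i (partial i (fun y => h y 0 j)) z.
  by rewrite exchange_big; apply: eq_bigr => j _; rewrite mulr_sumr.
have -> : gradv (fun i y => \sum_(j < m) w 0 j * partial i (fun y => h y 0 j) y) z z
    = \sum_(j < m) w 0 j * gradv (fun i => partial i (fun y => h y 0 j)) z z.
  rewrite /gradv; under eq_bigr do rewrite mulr_sumr.
  rewrite exchange_big; apply: eq_bigr => j _ /=; rewrite mulr_sumr.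
  by apply: eq_bigr => i _; ring.
rewrite !mulr_sumr -big_split big1 //= => j _.
by rewrite mulrCA [_ * (w 0 j * _)]mulrCA -mulrDr e0 mulr0.
Qed.
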